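(* Let $(V,f)$ and $(W,g)$ be bilinear lattices, $Z=V\otimes W$, and let $z\in Z\otimes\mathbb Q$ be a Wu class for $(Z,f\otimes g)$. Then $$\gamma\big(G_f\otimes W,\varphi_{f\otimes g,z}\circ j_f\big)=e^{\frac{\pi i}{4}\left(\sigma(f)\sigma(g)-(f\otimes g)_{\mathbb Q}(z,z)\right)}\,\overline{\gamma\big(V\otimes G_g,\varphi_{f\otimes g,z}\circ j_g\big)}.$$
   Context: A bilinear lattice $(V,f)$ is a finitely generated free abelian group $V$ with a symmetric nondegenerate bilinear form $f:V\times V\to\mathbb Z$; $f_{\mathbb Q}$ denotes its extension to $V_{\mathbb Q}=V\otimes\mathbb Q$, and $\sigma(f)$ its signature. The dual lattice is $V^{\sharp}=\{x\in V_{\mathbb Q}\mid f_{\mathbb Q}(x,V)\subset\mathbb Z\}$ and $G_f=V^{\sharp}/V$. A Wu class for $(V,f)$ is $v\in V_{\mathbb Q}$ with $f(x,x)-f_{\mathbb Q}(x,v)\in2\mathbb Z$ for all $x\in V$ (integral if $v\in V$). The discriminant of $(V,f,v)$ is the quadratic function $\varphi_{f,v}:G_f\to\mathbb Q/\mathbb Z$, $\varphi_{f,v}(x\bmod V)=\tfrac12\big(f_{\mathbb Q}(x,x)-f_{\mathbb Q}(x,v)\big)\bmod\mathbb Z$ for $x\in V^{\sharp}$. The form $f\otimes g$ on $Z=V\otimes W$ is $(f\otimes g)(x\otimes y,x'\otimes y')=f(x,x')g(y,y')$, and $G_{f\otimes g}=Z^{\sharp}/Z$. The map $j_f:G_f\otimes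 W\to G_{f\otimes g}$ sends $(x\bmod V)\otimes y\mapsto x\otimes y\bmod Z$ ($x\in V^{\sharp},y\in W$); $j_g:V\otimes G_g\to G_{f\otimes g}$ sends $x\otimes(y\bmod W)\mapsto x\otimes y\bmod Z$ ($x\in V,y\in W^{\sharp}$). For a quadratic function $q$ on a finite abelian group $G$ (a map $q:G\to\mathbb Q/\mathbb Z$ with $b_q(x,y)=q(x+y)-q(x)-q(y)$ bilinear), $G^\perp=\{x\mid b_q(x,G)=0\}$ and $\gamma(G,q)=|G|^{-1/2}|G^{\perp}|^{-1/2}\sum_{x\in G}e^{2\pi i q(x)}$; bar denotes complex conjugation. *)

(* Defs.v *)
From HB Require Import structures.
From mathcomp Require Import all_boot all_order all_algebra.
From mathcomp Require Import complex.
From mathcomp Require Import reals trigo.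

Set Implicit Arguments.
Unset Strict Implicit.
Unset Printing Implicit Defensive.

Import Order.TTheory GRing.Theory Num.Theory.
Local Open Scope ring_scope.

(* A bilinear lattice (V,f) is modelled as V = Z^n with Gram matrix F
   (symmetric, det F <> 0).  V_Q = Q^n (column vectors).
   Z = V (x) W = Z^n (x) Z^m is modelled as n x m integer matrices, via
   x (x) y |-> x *m y^T; Z (x) Q = n x m rational matrices. *)

Definition intmx (p q : nat) (A : 'M[int]_(p, q)) : 'M[rat]_(p, q) :=
  map_mx (fun z : int => z%:~R) A.

Definition is_int_mx (p q : nat) (X : 'M[rat]_(p, q)) : bool :=
  [forall i, forall j, X i j \is a Num.int].

Definition bform (n : nat) (F : 'M[int]_n) (x y : 'cV[rat]_n) : rat :=
  (x^T *m intmx F *m y) 0 0.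

(* x \in V^# : f_Q(x, V) \subset Z, tested on the standard basis of V = Z^n *)
Definition in_dual (n : nat) (F : 'M[int]_n) (x : 'cV[rat]_n) : bool :=
  [forall i : 'I_n, bform F x (delta_mx i 0) \is a Num.int].

(* (f (x) g)_Q on Z (x) Q: the bilinear extension of
   (x(x)y, x'(x)y') |-> f(x,x') g(y,y'); with x(x)y = x y^T this is
   tr(X^T F X' G). *)
Definition tform (n m : nat) (F : 'M[int]_n) (G : 'M[int]_m)
  (X Y : 'M[rat]_(n, m)) : rat :=
  \tr (X^T *m intmx F *m Y *m intmx G).

Definition is_Wu_class (n m : nat) (F : 'M[int]_n) (G : 'M[int]_m)
  (z : 'M[rat]_(n, m)) : Prop :=
  forall X : 'M[int]_(n, m),
    (tform F G (intmx X) (intmx X) - tform F G (intmx X) z) / 2 \is a Num.int.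

(* rational representative of the discriminant quadratic function
   phi_{f(x)g, z}(X mod Z) = 1/2 ((f(x)g)(X,X) - (f(x)g)(X,z)) mod Z *)
Definition phi (n m : nat) (F : 'M[int]_n) (G : 'M[int]_m)
  (z : 'M[rat]_(n, m)) (X : 'M[rat]_(n, m)) : rat :=
  (tform F G X X - tform F G X z) / 2.

(* elements of V^# (x) W  (every column, i.e. every V-component w.r.t. the
   basis of W, lies in V^#) *)
Definition in_dualV_tens_W (n m : nat) (F : 'M[int]_n) (X : 'M[rat]_(n, m)) : bool :=
  [forall k : 'I_m, in_dual F (col k X)].

(* elements of V (x) W^#  (every row, i.e. every W-component w.r.t. the
   basis of V, lies in W^#) *)
Definition in_V_tens_dualW (n m : nat) (G : 'M[int]_m) (X : 'M[rat]_(n, m)) : bool :=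
  [forall i : 'I_n, in_dual G (row i X)^T].

(* The common denominator D = |det F * det G|: every element of
   V^# (x) W and of V (x) W^# lies in (1/D) Z. *)
Definition denom (n m : nat) (F : 'M[int]_n) (G : 'M[int]_m) : nat :=
  absz (\det F * \det G).

Definition frac_mx (D n m : nat) (K : 'M['I_D]_(n, m)) : 'M[rat]_(n, m) :=
  \matrix_(i, j) ((K i j : nat)%:R / D%:R).

(* The finite group L / Z (for a lattice Z = Z^{n x m} <= L <= (1/D) Z^{n x m})
   represented by its unique coset representatives with entries in [0,1). *)
Definition coset_reps (D n m : nat) (inL : 'M[rat]_(n, m) -> bool)
  : seq 'M[rat]_(n, m) :=
  [seq X <- [seq frac_mx K | K : 'M['I_D]_(n, m)] | inL X].

Definition expi (R : realType) (t : R) : R[i] := (cos t +i* sin t)%C.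

(* gamma(G, q) = |G|^{-1/2} |G^perp|^{-1/2} sum_{x in G} e^{2 pi i q(x)},
   for G given by a list of coset representatives S and q given through a
   rational representative of its Q/Z-value; b_q(x,y) = q(x+y)-q(x)-q(y). *)
Definition gauss_gamma (R : realType) (n m : nat) (S : seq 'M[rat]_(n, m))
  (q : 'M[rat]_(n, m) -> rat) : R[i] :=
  let bq x y := q (x + y) - q x - q y in
  let Sperp := [seq x <- S | all (fun y => bq x y \is a Num.int) S] in
  ((Num.sqrt ((size S)%:R * (size Sperp)%:R : R))^-1)%:C%C *
  \sum_(x <- S) expi (2 * pi * ratr (q x)).

(* sigma(A) = s : A symmetric rational matrix congruent over Q to a diagonal
   matrix with (#positive - #negative) diagonal entries equal to s
   (well defined by Sylvester's law of inertia). *)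
Definition is_signature (n : nat) (A : 'M[rat]_n) (s : int) : Prop :=
  exists P : 'M[rat]_n,
    [/\ P \in unitmx, is_diag_mx (P^T *m A *m P) &
        s = (#|[set i : 'I_n | 0 < (P^T *m A *m P) i i]|)%:Z
            - (#|[set i : 'I_n | (P^T *m A *m P) i i < 0]|)%:Z].

(* Main.v *)
From mathcomp Require Import ring lra zify.
From mathcomp Require Import all_classical all_analysis.
Require Import Defs.
From HB Require Import structures.
From mathcomp Require Import all_boot all_order all_algebra.
From mathcomp Require Import complex.
From mathcomp Require Import reals trigo.
Import Order.TTheory GRing.Theory Num.Theory.
Import numFieldNormedType.Exports ComplexField.Normc.
Local Open Scope ring_scope.

(** In the discriminant group of [f (x) g], the subgroups [V^# (x) W / Z] and
    [V (x) W^# / Z] are orthogonal complements of each other.  For a quadratic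
    function [q] on a finite group [E] and a subgroup [B], orthogonality of
    characters gives [S_E * conj S_B = |B| * S_(B^perp)], so everything reduces
    to the value of the Gauss sum [S_E] of the full group (the formula of van
    der Blij and Milgram).

    The same identity lets us work in the discriminant group of any sublattice
    of [Z]; we choose the one spanned by [P e_i (x) Q e_j] where the columns of
    [P] and [Q] are orthogonal bases over the rationals.  There [S_E] is a
    product of the one-dimensional sums [S(d) = sum_(k < d) e(k^2 / 2d)], [d]
    even, and the claim is [S(d) = sqrt d * e(1/8)].

    For this, [S(d t^2) = t S(d)] exactly, while [S(N) / sqrt N], up to a tail
    bounded by partial summation, is a Riemann sum of the Fresnel integral of
    [e(x^2 / 2)].  Hence [S(d) / sqrt d] does not depend on [d], and [d = 2]
    gives its value. *)

(** * Exponentials on the unit circle and elementary bounds for the sine *)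

Section UnitCircle.
Context {R : realType}.
Implicit Types (x y : R) (z : R[i]).

Definition expi2pi x : R[i] := expi (2 * pi * x).

Lemma expiD x y : expi (x + y) = expi x * expi y.
Proof.
rewrite /expi cosD sinD; apply/eqP; rewrite eq_complex /=.
by rewrite eqxx /= addrC (mulrC (sin x)) eqxx.
Qed.

Lemma expi0 : expi (0 : R) = 1.
Proof. by rewrite /expi cos0 sin0. Qed.

Lemma conjc_expi x : (expi x)^*%C = expi (- x).
Proof. by rewrite /expi cosN sinN. Qed.

Lemma normc_expi x : normc (expi x) = 1.
Proof. by rewrite /= cos2Dsin2 sqrtr1. Qed.

Lemma expi2piD x y : expi2pi (x + y) = expi2pi x * expi2pi y.
Proof. by rewrite /expi2pi mulrDr expiD. Qed.

Lemma expi2pi0 : expi2pi 0 = 1.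
Proof. by rewrite /expi2pi mulr0 expi0. Qed.

Lemma conjc_expi2pi x : (expi2pi x)^*%C = expi2pi (- x).
Proof. by rewrite /expi2pi conjc_expi mulrN. Qed.

Lemma normc_expi2pi x : normc (expi2pi x) = 1.
Proof. exact: normc_expi. Qed.

Lemma expi2pi_neq0 x : expi2pi x != 0.
Proof.
apply/eqP => h; have := normc_expi2pi x.
by rewrite h normc0 => /eqP; rewrite eq_sym oner_eq0.
Qed.

Lemma expi2piN x : expi2pi (- x) = (expi2pi x)^-1.
Proof.
apply: (mulIf (expi2pi_neq0 x)).
by rewrite -expi2piD addNr expi2pi0 mulVf ?expi2pi_neq0.
Qed.

Lemma expi2pi1 : expi2pi 1 = 1.
Proof. by rewrite /expi2pi mulr1 mulr_natl /expi cos2pi sin2pi. Qed.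

Lemma expi2pi_nat (k : nat) : expi2pi k%:R = 1.
Proof. by elim: k => [|k IH]; rewrite ?expi2pi0 // -natr1 expi2piD IH expi2pi1 mulr1. Qed.

Lemma expi2pi_int (k : int) : expi2pi k%:~R = 1.
Proof.
case: k => k; first exact: expi2pi_nat.
by rewrite NegzE mulrNz expi2piN expi2pi_nat invr1.
Qed.

Lemma expi2pi_sum (I : Type) (r : seq I) (P : pred I) (f : I -> R) :
  expi2pi (\sum_(i <- r | P i) f i) = \prod_(i <- r | P i) expi2pi (f i).
Proof. by rewrite (big_morph expi2pi expi2piD expi2pi0). Qed.

(** After subtracting the integer part, [cos (2 pi y) = 1] with [0 <= y < 1] forces
    [sin (pi y) = 0], whereas the sine is positive strictly between 0 and pi. *)
Lemma expi2pi_eq1 x : expi2pi x = 1 -> exists k : int, x = k%:~R.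
Proof.
move=> h; exists (Num.floor x); apply/eqP; rewrite -subr_eq0; apply/eqP.
set y := x - _.
have yb : 0 <= y < 1.
  by rewrite subr_ge0 ge_floor /= ltrBlDl -intrD1 lt_succ_floor.
have hy : expi2pi y = 1.
  by rewrite expi2piD h mul1r -mulrNz expi2pi_int.
have : sin (pi * y) = 0.
  have c1 : cos ((pi * y) *+ 2) = 1.
    by move: hy => [+ _]; rewrite -mulrA mulr_natl.
  have : sin (pi * y) ^+ 2 = 0.
    by move: c1; rewrite cos_mulr2n sin2cos2; lra.
  by move=> /eqP; rewrite expf_eq0 /= => /eqP.
move=> s0; apply/eqP; rewrite eq_le (andP yb).1 andbT leNgt; apply/negP => y0.
have := @sin_gt0_pi R (pi * y); rewrite s0 ltxx mulr_gt0 ?pi_gt0 //=.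
by rewrite -[ltRHS]mulr1 ltr_pM2l ?pi_gt0 // (andP yb).2 => /(_ isT).
Qed.

(** Factoring out the exponential at the midpoint [(x + y) / 2] leaves [2 i sin (pi (x - y))]. *)
Lemma expi2pi_subE x y :
  normc (expi2pi x - expi2pi y) = 2 * `|sin (pi * (x - y))|.
Proof.
have -> : expi2pi x - expi2pi y =
    expi2pi ((x + y) / 2) * (0 +i* (2 * sin (pi * (x - y))))%C.
  have -> : (0 +i* (2 * sin (pi * (x - y))))%C =
      expi2pi ((x - y) / 2) - expi2pi (- ((x - y) / 2)) :> R[i].
    rewrite /expi2pi mulrN /expi cosN sinN.
    have -> : 2 * pi * ((x - y) / 2) = pi * (x - y) by field.
    by apply/eqP; rewrite eq_complex /= subrr eqxx /= opprK mulr_natl mulr2n.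
  by rewrite mulrBr -!expi2piD; congr (expi2pi _ - expi2pi _); field.
rewrite normcM normc_expi2pi mul1r /= expr0n add0r sqrtr_sqr.
by rewrite normrM ger0_norm.
Qed.

Lemma sin_le_id x : 0 <= x -> sin x <= x.
Proof.
rewrite le_eqVlt => /orP[/eqP <-|x0]; first by rewrite sin0.
have [|c _] := MVT x0 (fun t _ => is_derive_sin t).
  by apply: continuous_subspaceT => y; exact: continuous_sin.
rewrite sin0 !subr0 => ->; rewrite -[leRHS]mul1r ler_wpM2r ?cos_le1 //.
exact: ltW.
Qed.

Lemma normr_sin_le x : `|sin x| <= `|x|.
Proof.
wlog x0 : x / 0 <= x => [h|].
  have [|/ltW x0] := leP 0 x; first exact: h.
  by rewrite -normrN -sinN -(normrN x); apply: h; rewrite oppr_ge0.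
rewrite (ger0_norm x0) ler_norml sin_le_id // andbT.
have [h|h] := leP x pi.
  by apply: (le_trans _ (sin_ge0_pi _)); rewrite ?oppr_le0 ?x0.
by apply: (le_trans _ (sin_geN1 x)); rewrite lerN2; have := pi_ge2 R; lra.
Qed.

Lemma cos_piquarter_sqr : cos (pi / 4 : R) ^+ 2 = 2^-1.
Proof.
have := @cos_mulr2n R (pi / 4).
have -> : (pi / 4) *+ 2 = pi / 2 :> R by rewrite -mulr_natl; field.
by rewrite cos_pihalf; lra.
Qed.

Lemma cos_piquarter_gt0 : 0 < cos (pi / 4 : R).
Proof. by apply: cos_gt0_pihalf; have := pi_gt0 R; lra. Qed.

(** A weak Jordan inequality, used to bound [e(x) - 1] away from 0. On [[0, pi / 4]] the mean value
    theorem gives [sin y >= y cos (pi / 4)]; doubling the angle then produces the factor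
    [2 cos (pi / 4) ^ 2 = 1]. *)
Lemma sin_ge_half x : 0 <= x <= pi / 2 -> x / 2 <= sin x.
Proof.
have small y : 0 <= y <= pi / 4 -> y * cos (pi / 4) <= sin y.
  move=> /andP[]; rewrite le_eqVlt => /orP[/eqP <-|y0] y4.
    by rewrite sin0 mul0r.
  have [|c c01] := MVT y0 (fun t _ => is_derive_sin t).
    by apply: continuous_subspaceT => t; exact: continuous_sin.
  rewrite sin0 !subr0 => ->; rewrite mulrC ler_wpM2r ?ltW //.
  move: c01; rewrite in_itv /= => /andP[c0 cy].
  have := @ltr_cos R; have p0 := pi_gt0 R.
  by move=> H; rewrite H ?in_itv /=; lra.
move=> /andP[x0 x2].
have -> : x = (x / 2) *+ 2 by rewrite -mulr_natl; field.
set y := x / 2; have yb : 0 <= y <= pi / 4 by rewrite /y; lra.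
rewrite sin_mulr2n.
have s := small _ yb; have c4 := cos_piquarter_sqr.
have c0 := cos_piquarter_gt0; have p0 := pi_gt0 R.
have cy : cos (pi / 4) <= cos y.
  case/andP: yb => y0 y4.
  move: y4; rewrite le_eqVlt => /orP[/eqP ->//|y4].
  by apply: ltW; rewrite ltr_cos ?in_itv /=; lra.
have y0 : 0 <= y by case/andP: yb.
have h1 : cos (pi / 4) * (y * cos (pi / 4)) <= cos y * sin y.
  by apply: ler_pM => //; [exact: ltW|apply: mulr_ge0 => //; exact: ltW].
move: h1; rewrite mulrCA -expr2 c4; set w := _ * sin y.
by move: (y) (w) => {small s c4 c0 p0 cy y0 yb} y' w'; lra.
Qed.

End UnitCircle.

(** * One-dimensional Gauss sums: scaling by squares and bounds for tails *)

Lemma sum_nat_blocks (V : nmodType) (a b : nat) (F : nat -> V) :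
  \sum_(0 <= k < a * b) F k = \sum_(0 <= v < a) \sum_(0 <= u < b) F (v * b + u)%N.
Proof.
elim: a => [|a IH]; first by rewrite mul0n !big_nil.
rewrite big_nat_recr //= -IH (big_cat_nat (n := a * b)) ?mulSn ?leq_addl //=.
congr (_ + _); rewrite -{1}[(a * b)%N]add0n big_addn.
have -> : (b + a * b - a * b = b)%N by lia.
by apply: eq_bigr => i _; rewrite addnC.
Qed.

Section GaussSum.
Context {R : realType}.

(** With the 2 in the denominator, the term depends only on [k] modulo [N] exactly when [N] is even;
    hence the parity hypotheses below. *)
Definition gterm (N k : nat) : R[i] := expi2pi (k%:R ^+ 2 / (2 * N%:R)).
Definition gauss_sum (N : nat) : R[i] := \sum_(0 <= k < N) gterm N k.

Lemma gtermD (N k l : nat) :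
  gterm N (k + l) = gterm N k * expi2pi (k%:R * l%:R / N%:R) * gterm N l.
Proof.
rewrite /gterm -!expi2piD; congr expi2pi; rewrite natrD.
(* For [N = 0] the convention [0^-1 = 0] makes all exponents vanish. *)
have [->|N0] := eqVneq (N%:R : R) 0; first by rewrite mulr0 invr0 !mulr0 !addr0.
by field.
Qed.

Lemma gterm0 (N : nat) : gterm N 0 = 1.
Proof. by rewrite /gterm expr0n mul0r expi2pi0. Qed.

(** A geometric sum of powers of [w = e(u / t)]: since [w ^ t = 1], it vanishes unless [w = 1], that
    is unless [t] divides [u]. *)
Lemma sum_expi2pi_frac (t u : nat) : (0 < t)%N ->
  \sum_(0 <= v < t) expi2pi (u%:R * v%:R / t%:R : R) = if (t %| u)%N then t%:R else 0.
Proof.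
move=> t0; have tn0 : (t%:R : R) != 0 by rewrite pnatr_eq0 -lt0n.
have [/dvdnP[q ->]|ndvd] := boolP (t %| u)%N.
  rewrite (eq_bigr (fun => 1)) => [|v _].
    by rewrite sumr_const_nat subn0.
  have -> : (q * t)%:R * v%:R / t%:R = (q * v)%:R :> R by rewrite !natrM; field.
  exact: expi2pi_nat.
set w := expi2pi (u%:R / t%:R : R).
have wX (v : nat) : expi2pi (u%:R * v%:R / t%:R : R) = w ^+ v.
  elim: v => [|v IH]; first by rewrite mulr0 mul0r expi2pi0.
  rewrite exprS -IH -expi2piD; congr expi2pi; rewrite -natr1; field.
  exact: tn0.
rewrite (eq_bigr (fun v => w ^+ v)) => [|v _]; last exact: wX.
have w1 : w != 1.
  apply: contraNneq ndvd => /expi2pi_eq1[k hk].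
  have : (u%:Z = k * t%:Z)%R.
    apply: (@intr_inj R); rewrite intrM -hk /=.
    by rewrite -!pmulrn divfK.
  move=> h; have : (t%:Z %| u%:Z)%Z by rewrite h dvdz_mull.
  by [].
have /eqP := subrX1 w t; rewrite -wX mulfK // expi2pi_nat subrr eq_sym.
by rewrite mulf_eq0 subr_eq0 (negPf w1) /= big_mkord => /eqP.
Qed.

(* Splitting [k = v (d t) + u] makes the sum over [v] vanish unless [t]
   divides [u]. *)
Lemma gauss_sum_square (d t : nat) : ~~ odd d -> (0 < d)%N -> (0 < t)%N ->
  gauss_sum (d * t ^ 2) = t%:R * gauss_sum d.
Proof.
move=> od d0 t0; have tn0 : (t%:R : R) != 0 by rewrite pnatr_eq0 -lt0n.
have dn0 : (d%:R : R) != 0 by rewrite pnatr_eq0 -lt0n.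
rewrite /gauss_sum; set N := (d * t ^ 2)%N.
have natN : N%:R = d%:R * t%:R ^+ 2 :> R by rewrite natrM natrX.
have {1}-> : N = (t * (d * t))%N by rewrite /N; nia.
rewrite sum_nat_blocks exchange_big /=.
have gt u v : gterm N (v * (d * t) + u) = gterm N u * expi2pi (u%:R * v%:R / t%:R).
  rewrite gtermD mulrC; congr (_ * _).
  rewrite -[RHS]mul1r; congr (_ * _).
    rewrite /gterm natN !natrM.
    (* Evenness of [d] enters here: the exponent is the integer [v^2 (d / 2)]. *)
    have -> : (v%:R * (d%:R * t%:R)) ^+ 2 / (2 * (d%:R * t%:R ^+ 2)) =
       (v ^ 2 * d./2)%N%:R :> R.
      have -> : d%:R = 2 * (d./2)%:R :> R.
        by rewrite -natrM; congr (_%:R); have := odd_double_half d; lia.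
      rewrite (natrM _ (v ^ 2)) natrX; field.
      rewrite tn0 pnatr_eq0 /=; have := odd_double_half d; lia.
    exact: expi2pi_nat.
  congr expi2pi; rewrite natN !natrM; field; exact/andP.
under eq_bigr => u _ do under eq_bigr => v _ do rewrite gt.
under eq_bigr => u _ do rewrite -mulr_sumr sum_expi2pi_frac //.
rewrite sum_nat_blocks mulr_sumr; apply: eq_bigr => w _.
(* In each block of length [t] only the first index is divisible by [t]. *)
rewrite big_ltn // addn0 dvdn_mull // big_nat big1 ?addr0 => [|i /andP[i0 it]].
  rewrite mulrC; congr (_ * _); rewrite /gterm natN; congr expi2pi.
  by rewrite !natrM; field; exact/andP.
by rewrite dvdn_addr ?dvdn_mull // gtnNdvd // mulr0.
Qed.

(** The reflection [k -> 2p - k] changes the exponent by the integer [p - k]. It maps the upper half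
    to the indices 1 to [p], whence the corrections by the terms at [p] and at 0. Folding keeps the
    phase increments at most 1/2, as summation by parts requires. *)
Lemma gauss_sum_fold (p : nat) : (0 < p)%N ->
  gauss_sum p.*2 = 2 * \sum_(0 <= k < p) gterm p.*2 k + gterm p.*2 p - 1.
Proof.
move=> p0; have pn0 : (p%:R : R) != 0 by rewrite pnatr_eq0 -lt0n.
have sym k : (k <= p.*2)%N -> gterm p.*2 (p.*2 - k) = gterm p.*2 k.
  move=> kp; rewrite /gterm natrB // -muln2 natrM.
  have -> : (p%:R * 2 - k%:R) ^+ 2 / (2 * (p%:R * 2)) =
    k%:R ^+ 2 / (2 * (p%:R * 2)) + (p%:Z - k%:Z)%:~R :> R.
    by rewrite rmorphB /=; field.
  by rewrite expi2piD expi2pi_int mulr1.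
rewrite /gauss_sum (big_cat_nat (n := p)) //=; last lia.
have -> : \sum_(p <= k < p.*2) gterm p.*2 k = \sum_(0 <= k < p) gterm p.*2 k.+1.
  rewrite big_nat_rev /= -{1}[p]add0n big_addn.
  have -> : (p.*2 - p = p)%N by lia.
  rewrite !big_nat; apply: eq_bigr => i /andP[_ ip].
  by rewrite -sym; [congr gterm; lia|lia].
have := @big_nat_recl _ 0 +%R p 0%N (gterm p.*2) (leq0n _).
rewrite big_nat_recr //= gterm0 => h.
by rewrite mulr_natl mulr2n -!addrA; congr (_ + _); rewrite addrA h; ring.
Qed.

(** The phase increment [((k + 1)^2 - k^2) / 2N] between consecutive terms. *)
Definition gangle (N k : nat) : R := (2 * k%:R + 1) / (2 * N%:R).
(** The coefficient that writes a term as a difference: [gterm N k = gcoef N k * (gterm N k.+1 -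
    gterm N k)]. *)
Definition gcoef (N k : nat) : R[i] := (expi2pi (gangle N k) - 1)^-1.

Lemma gtermS (N k : nat) : gterm N k.+1 = gterm N k * expi2pi (gangle N k).
Proof.
rewrite /gterm -expi2piD; congr expi2pi; rewrite /gangle -natr1.
have [->|N0] := eqVneq (N%:R : R) 0; first by rewrite mulr0 invr0 !mulr0 !addr0.
by field.
Qed.

Lemma expi2piB1_ge (x : R) : 0 <= x <= 2^-1 -> pi * x <= normc (expi2pi x - 1).
Proof.
move=> /andP[x0 x2]; rewrite -expi2pi0 expi2pi_subE subr0.
have p0 := pi_gt0 R.
have /sin_ge_half h : 0 <= pi * x <= pi / 2.
  by rewrite mulr_ge0 ?(ltW p0) //= ler_wpM2l ?(ltW p0).
by have := ler_norm (sin (pi * x)); lra.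
Qed.

Lemma gangle_gt0 (N k : nat) : (0 < N)%N -> 0 < gangle N k.
Proof. by move=> N0; rewrite divr_gt0 ?mulr_gt0 ?ltr0n // ltr_wpDl // mulr_ge0. Qed.

Lemma gangle_le_half (N k : nat) : (k.*2.+1 <= N)%N -> gangle N k <= 2^-1.
Proof.
move=> kN; have N0 : 0 < N%:R :> R by rewrite ltr0n; lia.
rewrite /gangle ler_pdivrMr ?mulr_gt0 //.
have : (k.*2.+1)%:R <= N%:R :> R by rewrite ler_nat.
by rewrite -natr1 -muln2 natrM; lra.
Qed.

Lemma gangleS_sub (N k : nat) : (0 < N)%N -> gangle N k.+1 - gangle N k = N%:R^-1.
Proof.
move=> N0; rewrite /gangle -natr1; field.
by rewrite pnatr_eq0 -lt0n.
Qed.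

Lemma normc_gcoef (N k : nat) : (k.*2.+1 <= N)%N -> normc (gcoef N k) <= (pi * gangle N k)^-1.
Proof.
move=> kN; have t0 : 0 < gangle N k by apply: gangle_gt0; lia.
rewrite /gcoef normcV lef_pV2 ?posrE.
- by apply: expi2piB1_ge; rewrite ltW //= gangle_le_half.
- apply: (lt_le_trans (y := pi * gangle N k)); first by rewrite mulr_gt0 ?pi_gt0.
  by apply: expi2piB1_ge; rewrite ltW //= gangle_le_half.
- by rewrite mulr_gt0 ?pi_gt0.
Qed.

Lemma expi2piB1_neq0 (N k : nat) : (k.*2.+1 <= N)%N -> expi2pi (gangle N k) - 1 != 0.
Proof.
move=> kN; have t0 : 0 < gangle N k by apply: gangle_gt0; lia.
apply/eqP => h.
have := @expi2piB1_ge (gangle N k); rewrite h normc0 ltW //= gangle_le_half // => /(_ isT).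
by rewrite leNgt mulr_gt0 // pi_gt0.
Qed.

(** The difference of two reciprocals has numerator at most [2 pi] times the difference of the
    angles, and denominators at least [pi] times each angle. The resulting bound is a difference of
    consecutive values, so that the total variation telescopes. *)
Lemma normc_gcoefS_sub (N k : nat) : (k.+1.*2.+1 <= N)%N ->
  normc (gcoef N k.+1 - gcoef N k) <= 2 * ((pi * gangle N k)^-1 - (pi * gangle N k.+1)^-1).
Proof.
move=> kN; have N0 : (0 < N)%N by lia.
have t0 := gangle_gt0 N k N0; have t1 := gangle_gt0 N k.+1 N0.
have p0 := pi_gt0 R.
have kN' : (k.*2.+1 <= N)%N by lia.
have n0 := expi2piB1_neq0 _ _ kN'; have n1 := expi2piB1_neq0 _ _ kN.
have -> : gcoef N k.+1 - gcoef N k =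
  (expi2pi (gangle N k) - expi2pi (gangle N k.+1)) * (gcoef N k * gcoef N k.+1).
  by rewrite /gcoef; field; rewrite n0 n1.
rewrite !normcM.
have fE (c a b : R) : c != 0 -> a != 0 -> b != 0 ->
    2 * ((c * a)^-1 - (c * b)^-1) = 2 * (c * (b - a)) * ((c * a)^-1 * (c * b)^-1).
  by move=> c0 a0 b0; field; rewrite a0 b0 c0.
rewrite fE ?gt_eqF //.
have nn (x : R[i]) : 0 <= normc x by case: x => a b /=; exact: sqrtr_ge0.
apply: ler_pM => //; first by rewrite mulr_ge0.
  rewrite expi2pi_subE ler_pM2l //; apply: (le_trans (normr_sin_le _)).
  rewrite normrM gtr0_norm // distrC gangleS_sub // ger0_norm ?invr_ge0 //.
by apply: ler_pM => //; exact: normc_gcoef.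
Qed.

(** Abel summation applied to [gterm N k = gcoef N k * (gterm N k.+1 - gterm N k)]. *)
Lemma sum_gterm_by_parts (N K L : nat) : ((K + L).*2.+1 <= N)%N ->
  \sum_(0 <= k < L.+1) gterm N (K + k) =
  gcoef N (K + L) * gterm N (K + L).+1 - gcoef N K * gterm N K -
  \sum_(0 <= k < L) (gcoef N (K + k).+1 - gcoef N (K + k)) * gterm N (K + k).+1.
Proof.
have base k : (k.*2.+1 <= N)%N -> gterm N k = gcoef N k * (gterm N k.+1 - gterm N k).
  move=> kN; rewrite gtermS -{3}[gterm N k]mulr1 -mulrBr mulrCA.
  by rewrite /gcoef mulVf ?mulr1 // expi2piB1_neq0.
elim: L => [|L IH] KL.
  by rewrite big_nat1 big_nil subr0 addn0 -mulrBr -base //; lia.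
rewrite big_nat_recr //= IH; last by lia.
rewrite [in RHS]big_nat_recr //= addnS.
have E := base (K + L).+1; apply/eqP; rewrite -subr_eq0; apply/eqP.
transitivity (gterm N (K + L).+1 -
  gcoef N (K + L).+1 * (gterm N (K + L).+2 - gterm N (K + L).+1)); first by ring.
by rewrite -E ?subrr //; lia.
Qed.

(** With [b k = (pi * gangle N k)^-1], the boundary terms contribute at most [b K + b (K + L)] and
    the variation at most [2 (b K - b (K + L))]; together this is below [4 b K]. *)
Lemma gauss_sum_tail (N K p : nat) : (0 < K)%N -> (K <= p)%N -> (p.*2 <= N)%N ->
  normc (\sum_(K <= k < p) gterm N k) <= 4 * (pi * (K%:R / N%:R))^-1.
Proof.
move=> K0 Kp pN; have p0 := pi_gt0 R.
have N0 : (0 < N)%N by lia.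
have nn (x : R[i]) : 0 <= normc x by case: x => a b /=; exact: sqrtr_ge0.
have KN0 : 0 < K%:R / N%:R :> R by rewrite divr_gt0 ?ltr0n.
have B0 : 0 <= 4 * (pi * (K%:R / N%:R))^-1 :> R.
  by rewrite mulr_ge0 // invr_ge0 mulr_ge0 // ltW.
have [Kp'|Kp'] := eqVneq K p; first by rewrite big_geq ?normc0 // Kp'.
have [L pE] : exists L, p = (K + L).+1 by exists (p - K).-1%N; lia.
have KL : ((K + L).*2.+1 <= N)%N by lia.
have -> : \sum_(K <= k < p) gterm N k = \sum_(0 <= k < L.+1) gterm N (K + k).
  rewrite -{1}[K]add0n big_addn; have -> : (p - K = L.+1)%N by lia.
  by apply: eq_bigr => i _; rewrite addnC.
rewrite sum_gterm_by_parts //; set b := fun k => (pi * gangle N k)^-1.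
have thK : K%:R / N%:R <= gangle N K.
  rewrite /gangle ler_pdivrMr ?ltr0n // mulrAC ler_pdivlMr ?mulr_gt0 ?ltr0n //.
  have : 0 <= N%:R :> R by []. nra.
have bK : b K <= (pi * (K%:R / N%:R))^-1.
  rewrite lef_pV2 ?posrE; first by rewrite ler_pM2l.
    by apply: mulr_gt0 => //; exact: gangle_gt0.
  exact: mulr_gt0.
have bL : 0 <= b (K + L)%N by rewrite invr_ge0 mulr_ge0 ?ltW // gangle_gt0.
have tel : normc (\sum_(0 <= k < L) (gcoef N (K + k).+1 - gcoef N (K + k)) *
    gterm N (K + k).+1) <= 2 * (b K - b (K + L)%N).
  elim: L {pE bL} KL => [|L IH] KL; first by rewrite big_nil normc0 addn0 subrr mulr0.
  rewrite big_nat_recr //=; apply: (le_trans (le_normcD _ _)).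
  have -> : 2 * (b K - b (K + L.+1)%N) =
    2 * (b K - b (K + L)%N) + 2 * (b (K + L)%N - b (K + L).+1) by rewrite addnS; ring.
  apply: lerD; first by apply: IH; lia.
  by rewrite normcM normc_expi2pi mulr1; apply: normc_gcoefS_sub; lia.
apply: (le_trans (le_normcD _ _)); rewrite normcN.
have h1 := le_normcD (gcoef N (K + L) * gterm N (K + L).+1) (- (gcoef N K * gterm N K)).
rewrite normcN !normcM !normc_expi2pi !mulr1 in h1.
have h2 : normc (gcoef N (K + L)) <= b (K + L)%N by exact: normc_gcoef.
have h3 : normc (gcoef N K) <= b K by apply: normc_gcoef; lia.
lra.
Qed.
End GaussSum.

(** * Comparison with the Fresnel integral and the value of the Gauss sum *)

Section GaussSumValue.
Context {R : realType}.

Lemma antiderivative_ge0 (f : R -> R) : continuous f ->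
  exists Phi : R -> R, forall x : R, 0 <= x -> is_derive x 1 Phi (f x).
Proof.
(* Integrating from -1 makes 0 an interior point, so the derivative there is two-sided. *)
move=> cf; exists (fun x => \int[lebesgue_measure]_(t in [set` `[-1, x]]) f t)%R.
move=> x x0.
have xu : x < x + 1 by lra.
have Nx : -1 < x by lra.
have intf : lebesgue_measure.-integrable `[-1, x + 1]%classic (EFin \o f).
  apply: continuous_compact_integrable; first exact: segment_compact.
  by apply: continuous_subspaceT => t; exact: cf.
have [dF F'] := continuous_FTC1_closed xu intf Nx (cf x).
by apply: (DeriveDef dF); rewrite -derive1E F'.
Qed.

(** Left-endpoint rule. By the mean value theorem [Phi] grows over a step by [h * g (pi * c ^ 2)]
    for some intermediate [c], so the error of that step is at most [h * pi] times the increment of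
    [x ^ 2]; these increments telescope. *)
Lemma riemann_sum_lipschitz_sqr (g Phi : R -> R) (h : R) (K : nat) :
  (forall a b, `|g a - g b| <= `|a - b|) ->
  (forall x : R, 0 <= x -> is_derive x 1 Phi (g (pi * x ^+ 2))) -> 0 < h ->
  `|\sum_(0 <= k < K) h * g (pi * (k%:R * h) ^+ 2) - (Phi (K%:R * h) - Phi 0)|
    <= pi * K%:R ^+ 2 * h ^+ 3.
Proof.
move=> lg dP h0; have p0 := pi_gt0 R.
elim: K => [|K IH].
  by rewrite big_nil mul0r subrr subrr normr0 expr0n /= mulr0 mul0r.
have lt : K%:R * h < K.+1%:R * h by rewrite ltr_pM2r // ltr_nat.
have K0 : 0 <= K%:R * h by rewrite mulr_ge0 // ltW.
have [||c] := @MVT R Phi (fun x => g (pi * x ^+ 2)) _ _ lt.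
- by move=> x; rewrite in_itv /= => /andP[/ltW x1 _]; apply: dP; exact: le_trans x1.
- apply: derivable_within_continuous => x; rewrite in_itv /= => /andP[x1 _].
  by have [] := dP x (le_trans K0 x1).
rewrite in_itv /= => /andP[c1 c2].
have -> : K.+1%:R * h - K%:R * h = h by rewrite -natr1; ring.
move=> E; rewrite big_nat_recr //=.
set S := \sum_(0 <= k < K) _ in IH *.
have -> : S + h * g (pi * (K%:R * h) ^+ 2) - (Phi (K.+1%:R * h) - Phi 0) =
  (S - (Phi (K%:R * h) - Phi 0)) + h * (g (pi * (K%:R * h) ^+ 2) - g (pi * c ^+ 2)).
  by rewrite -[Phi (K.+1%:R * h)](subrK (Phi (K%:R * h))) E; ring.
apply: (le_trans (ler_normD _ _)).
have -> : pi * K.+1%:R ^+ 2 * h ^+ 3 =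
  pi * K%:R ^+ 2 * h ^+ 3 + h * (pi * ((K.+1%:R * h) ^+ 2 - (K%:R * h) ^+ 2)).
  by rewrite -natr1; ring.
apply: lerD => //; rewrite normrM (gtr0_norm h0) ler_pM2l //.
apply: (le_trans (lg _ _)); rewrite -mulrBr normrM (gtr0_norm p0) ler_pM2l //.
have s1 : (K%:R * h) ^+ 2 <= c ^+ 2 by rewrite lerXn2r ?nnegrE //; lra.
have s2 : c ^+ 2 <= (K.+1%:R * h) ^+ 2 by rewrite lerXn2r ?nnegrE //; lra.
by rewrite ler0_norm; lra.
Qed.

Lemma antiderivative_lipschitz (f Phi : R -> R) (x y : R) :
  (forall x, `|f x| <= 1) -> (forall x : R, 0 <= x -> is_derive x 1 Phi (f x)) ->
  0 <= x <= y -> `|Phi y - Phi x| <= y - x.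
Proof.
move=> f1 dP /andP[x0]; rewrite le_eqVlt => /orP[/eqP <-|xy].
  by rewrite !subrr normr0.
have [||c _ ->] := @MVT R Phi f _ _ xy.
- by move=> t; rewrite in_itv /= => /andP[/ltW t1 _]; apply: dP; exact: le_trans t1.
- apply: derivable_within_continuous => t; rewrite in_itv /= => /andP[t1 _].
  by have [] := dP t (le_trans x0 t1).
by rewrite normrM (gtr0_norm (_ : 0 < y - x)) ?subr_gt0 // -[leRHS]mul1r ler_wpM2r ?f1 //; lra.
Qed.

Lemma cos_lipschitz (a b : R) : `|cos a - cos b| <= `|a - b|.
Proof.
have -> : cos a - cos b = - 2 * (sin ((a + b) / 2) * sin ((a - b) / 2)).
  have {1}-> : a = (a + b) / 2 + (a - b) / 2 by field.
  have {3}-> : b = (a + b) / 2 - (a - b) / 2 by field.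
  by rewrite cosD cosB; ring.
rewrite normrM normrN normr_nat normrM.
have h1 := sin_max ((a + b) / 2); have h2 := normr_sin_le ((a - b) / 2).
rewrite normrM (ger0_norm (_ : 0 <= 2^-1)) ?invr_ge0 // in h2.
have := ler_pM (normr_ge0 _) (normr_ge0 _) h1 h2; lra.
Qed.

Lemma sin_lipschitz (a b : R) : `|sin a - sin b| <= `|a - b|.
Proof.
have := cos_lipschitz (a - pi / 2) (b - pi / 2); rewrite !cosBpihalf.
by have -> : a - pi / 2 - (b - pi / 2) = a - b by ring.
Qed.

(** The step is [1 / s]. The Riemann sum stops at [K / s], just before [T]; the quadrature error is
    at most [pi T^2 / s], with [pi <= 4], and the missing end piece costs at most [1 / s]. *)
Lemma riemann_head (g Phi : R -> R) (T s : R) :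
  (forall a b, `|g a - g b| <= `|a - b|) -> (forall a, `|g a| <= 1) ->
  (forall x : R, 0 <= x -> is_derive x 1 Phi (g (pi * x ^+ 2))) -> 0 <= T -> 0 < s ->
  `|(\sum_(0 <= k < Num.truncn (T * s)) g (pi * (k%:R / s) ^+ 2)) / s
     - (Phi T - Phi 0)| <= (4 * T ^+ 2 + 1) / s.
Proof.
move=> lg g1 dP T0 s0; set K := Num.truncn _; set h := s^-1.
have h0 : 0 < h by rewrite invr_gt0.
have Ts0 : 0 <= T * s by rewrite mulr_ge0 // ltW.
have /andP[KT TK] := Num.Theory.truncn_itv Ts0; rewrite -/K in KT TK.
have Kh : K%:R * h <= T by rewrite ler_pdivrMr.
have Th : T <= K%:R * h + h.
  by rewrite -{2}[h]mul1r -mulrDl natr1 ler_pdivlMr // ltW.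
have r := riemann_sum_lipschitz_sqr g Phi h K lg dP h0.
rewrite mulr_suml.
under eq_bigr => k _ do rewrite mulrC.
have a : `|Phi T - Phi (K%:R * h)| <= T - K%:R * h.
  apply: (antiderivative_lipschitz (fun x => g (pi * x ^+ 2))) => //.
  by rewrite Kh andbT mulr_ge0 // ltW.
set S := \sum_(0 <= k < K) _ in r *.
have -> : S - (Phi T - Phi 0) =
  (S - (Phi (K%:R * h) - Phi 0)) - (Phi T - Phi (K%:R * h)) by ring.
apply: (le_trans (ler_normB _ _)).
have : pi * K%:R ^+ 2 * h ^+ 3 <= 4 * T ^+ 2 * h.
  have -> : pi * K%:R ^+ 2 * h ^+ 3 = pi * (K%:R * h) ^+ 2 * h by ring.
  rewrite ler_pM2r //; apply: ler_pM; rewrite ?pi_ge0 ?sqr_ge0 //.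
    by have := pihalf_lt2 R; lra.
  by rewrite lerXn2r ?nnegrE // mulr_ge0 // ltW.
have -> : (4 * T ^+ 2 + 1) / s = 4 * T ^+ 2 * h + h by rewrite mulrDl mul1r.
by move: r a Kh Th; lra.
Qed.

Lemma normc_real (x : R) : normc x%:C%C = `|x|.
Proof. by rewrite /= expr0n /= addr0 sqrtr_sqr. Qed.

Lemma normc_le_normRe_normIm (x y : R) : normc (x +i* y)%C <= `|x| + `|y|.
Proof.
have -> : (x +i* y)%C = x%:C%C + (0 +i* y)%C :> R[i].
  by apply/eqP; rewrite eq_complex /= addr0 add0r !eqxx.
apply: (le_trans (le_normcD _ _)); rewrite normc_real lerD2l /=.
by rewrite expr0n add0r sqrtr_sqr.
Qed.

Lemma sum_complex (I : Type) (r : seq I) (P : pred I) (f g : I -> R) :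
  \sum_(i <- r | P i) (f i +i* g i)%C =
  ((\sum_(i <- r | P i) f i) +i* (\sum_(i <- r | P i) g i))%C :> R[i].
Proof. by elim/big_rec3: _ => [|i x y z _ ->]. Qed.

Lemma complex_divr (x y s : R) : ((x +i* y) / s%:C)%C = ((x / s) +i* (y / s))%C :> R[i].
Proof.
rewrite -fmorphV /=; apply/eqP; rewrite eq_complex /=.
by rewrite !mulr0 subr0 add0r !eqxx.
Qed.

(** The point is that [J] does not depend on [d]: [J T] is twice the Fresnel integral over [[0, T]].
    Replacing [d] by [d t^2] leaves the normalized sum unchanged and refines the mesh at will. *)
Lemma gauss_sum_approx : exists J : nat -> R[i], forall d T : nat,
  ~~ odd d -> (0 < d)%N -> (0 < T)%N ->
  normc (gauss_sum d / (Num.sqrt (d%:R : R))%:C%C - J T) <= 9 / T%:R.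
Proof.
have cc : continuous (fun x : R => cos (pi * x ^+ 2)).
  move=> x; apply: continuous_comp; last exact: continuous_cos.
  by apply: cvgM; [exact: cvg_cst|exact: exprn_continuous].
have cs : continuous (fun x : R => sin (pi * x ^+ 2)).
  move=> x; apply: continuous_comp; last exact: continuous_sin.
  by apply: cvgM; [exact: cvg_cst|exact: exprn_continuous].
have [Pc dPc] := antiderivative_ge0 _ cc; have [Ps dPs] := antiderivative_ge0 _ cs.
exists (fun T => 2 * ((Pc T%:R - Pc 0) +i* (Ps T%:R - Ps 0))%C) => d T od d0 T0.
(* Chosen so that [t = T (16 T^2 + 6)]. The head error, for cosine and sine and doubled by folding,
   is [(16 T^2 + 4) / s], the two folding corrections add [2 / s], and [s >= t] makes the total at
   most [1 / T]. *)
pose t := (16 * T ^ 3 + 6 * T)%N.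
have t0 : (0 < t)%N by rewrite /t; lia.
set J := ((Pc T%:R - Pc 0) +i* _)%C.
have dR0 : 0 < d%:R :> R by rewrite ltr0n.
pose N := (d * t ^ 2)%N; pose p := (d./2 * t ^ 2)%N.
have NE : N = p.*2 by rewrite /N /p; have := odd_double_half d; rewrite (negPf od); nia.
pose s : R := t%:R * Num.sqrt d%:R.
have tR0 : 0 < t%:R :> R by rewrite ltr0n.
have sd0 : 0 < Num.sqrt d%:R :> R by rewrite sqrtr_gt0.
have s0 : 0 < s by rewrite mulr_gt0.
have s2 : s ^+ 2 = N%:R by rewrite /s exprMn sqr_sqrtr ?ltW // /N natrM natrX mulrC.
have st : t%:R <= s.
  rewrite -[leLHS]mulr1 ler_pM2l // -[leLHS]sqrtr1 ler_sqrt //.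
  by rewrite ler1n.
have -> : gauss_sum d / (Num.sqrt (d%:R : R))%:C%C = gauss_sum N / s%:C%C.
  rewrite /N gauss_sum_square // /s rmorphM /= rmorph_nat -mulf_div divff ?mul1r //.
  by rewrite pnatr_eq0 -lt0n.
have T1 : 1 <= T%:R :> R by rewrite ler1n.
have tE : t%:R = 16 * T%:R ^+ 3 + 6 * T%:R :> R.
  by rewrite natrD (natrM _ 16) natrX (natrM _ 6).
pose K := Num.truncn (T%:R * s).
have Ts0 : 0 <= T%:R * s by rewrite mulr_ge0 // ltW.
have /andP[KT TK] := Num.Theory.truncn_itv Ts0; rewrite -/K in KT TK.
have sT : 2 * T%:R <= s by apply: le_trans st; rewrite tE; nra.
have s6 : 6 <= s by apply: le_trans st; rewrite tE; nra.
have Ks : T%:R * s / 2 <= K%:R by move: TK; rewrite -natr1; nra.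
have K0 : (0 < K)%N by rewrite -(ltr0n R); nra.
have Kp : (K <= p)%N.
  have : K.*2%:R <= N%:R :> R by rewrite -s2 -muln2 natrM; nra.
  by rewrite ler_nat NE leq_double.
have p0 : (0 < p)%N := leq_trans K0 Kp.
have gE k : gterm N k = (cos (pi * (k%:R / s) ^+ 2) +i* sin (pi * (k%:R / s) ^+ 2))%C.
  rewrite /gterm /expi2pi /expi.
  suff -> : 2 * pi * (k%:R ^+ 2 / (2 * N%:R)) = pi * (k%:R / s) ^+ 2 by [].
  by rewrite -s2; field; rewrite gt_eqF.
have hc := riemann_head cos Pc T%:R s cos_lipschitz (@cos_max R) dPc (ler0n _ _) s0.
have hs := riemann_head sin Ps T%:R s sin_lipschitz (@sin_max R) dPs (ler0n _ _) s0.
have tail := gauss_sum_tail (R := R) N K p K0 Kp (_ : (p.*2 <= N)%N).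
rewrite {1}NE gauss_sum_fold // -NE (big_cat_nat (n := K)) //=.
set A := \sum_(0 <= k < K) _; set B := \sum_(K <= k < p) _ in tail *.
have hA : normc (A / s%:C%C - J) <= 2 * ((4 * T%:R ^+ 2 + 1) / s).
  rewrite /A (eq_bigr _ (fun k _ => gE k)) sum_complex complex_divr /J.
  apply: (le_trans (normc_le_normRe_normIm _ _)); move: hc hs; rewrite -/K; lra.
have ns : normc (s%:C%C)^-1 = s^-1 by rewrite normcV normc_real gtr0_norm.
(* As [s^2 = N], [K >= T s / 2] and [pi >= 2], the tail bound [4 N / (pi K)] divided by [s] is at
   most [4 / T]; doubled, it supplies 8 of the 9 in the final estimate. *)
have TR0 : 0 < T%:R :> R by rewrite ltr0n.
have hB : normc (B / s%:C%C) <= 4 / T%:R.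
  rewrite normcM ns ler_pdivrMr //; apply: le_trans (tail _) _; first by rewrite NE.
  have KR0 : 0 < K%:R :> R by rewrite ltr0n.
  have NR0 : 0 < N%:R :> R by rewrite -s2 exprn_gt0.
  rewrite -mulrA ler_pM2l // -[leRHS]invrK.
  rewrite lef_pV2 ?posrE ?invr_gt0 ?mulr_gt0 ?invr_gt0 ?pi_gt0 //.
  rewrite invfM invrK mulrA ler_pdivlMr // -s2.
  have -> : T%:R / s * s ^+ 2 = T%:R * s by field; rewrite gt_eqF.
  have := pi_ge2 R; nra.
have hg : normc ((gterm N p - 1) / s%:C%C) <= 2 / s.
  rewrite normcM ns ler_pM2r ?invr_gt0 //; apply: (le_trans (le_normcD _ _)).
  by rewrite normcN normc_expi2pi normc1.
have n2 (x : R[i]) : normc (2 * x) = 2 * normc x.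
  by rewrite normcM -(rmorph_nat (real_complex R) 2) normc_real ger0_norm.
have -> : (2 * (A + B) + gterm N p - 1) / s%:C%C - 2 * J =
    (2 * (A / s%:C%C - J) + 2 * (B / s%:C%C)) + (gterm N p - 1) / s%:C%C by ring.
apply: (le_trans (le_normcD _ _)).
have h1 := le_normcD (2 * (A / s%:C%C - J)) (2 * (B / s%:C%C)); rewrite !n2 in h1.
have h2 : (16 * T%:R ^+ 2 + 6) / s <= T%:R^-1.
  rewrite ler_pdivrMr // (mulrC _ s) ler_pdivlMr //; apply: le_trans st; rewrite tE.
  by rewrite le_eqVlt; apply/orP; left; apply/eqP; ring.
have E1 : 2 * (2 * ((4 * T%:R ^+ 2 + 1) / s)) + 2 / s = (16 * T%:R ^+ 2 + 6) / s.
  by field; rewrite gt_eqF.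
move: hA hB hg h1 h2 E1; lra.
Qed.

(** The sum has two terms, [1 + e(1/4) = 1 + i]. *)
Lemma gauss_sum2 : gauss_sum 2 / (Num.sqrt (2 : R))%:C%C = expi (pi / 4 : R).
Proof.
have E : gauss_sum 2 = (1 +i* 1)%C :> R[i].
  rewrite /gauss_sum big_nat_recl // big_nat1 gterm0 /gterm /expi2pi.
  have -> : 2 * pi * (1 ^+ 2 / (2 * 2)) = pi / 2 :> R by field.
  rewrite /expi cos_pihalf sin_pihalf; apply/eqP; rewrite eq_complex /=.
  by rewrite addr0 add0r !eqxx.
have c0 := cos_piquarter_gt0 (R := R); have c2 := cos_piquarter_sqr (R := R).
have sc : sin (pi / 4 : R) = cos (pi / 4).
  by rewrite -cosBpihalf -cosN; congr cos; field.
have cE : 1 / Num.sqrt 2 = cos (pi / 4 : R).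
  rewrite mul1r -sqrtrV // -c2 sqrtr_sqr gtr0_norm //.
by rewrite E complex_divr /expi sc cE.
Qed.

(** The normalized sums for [d] and for 2 are both within [9 / T] of the same [J T], for every [T];
    hence they coincide, and the Fresnel integral need not be evaluated. *)
Lemma gauss_sum_value (d : nat) : ~~ odd d -> (0 < d)%N ->
  gauss_sum d = (Num.sqrt (d%:R : R))%:C%C * expi (pi / 4).
Proof.
move=> od d0; have [J HJ] := gauss_sum_approx.
have sn0 : (Num.sqrt (d%:R : R))%:C%C != 0.
  by rewrite fmorph_eq0 gt_eqF // sqrtr_gt0 ltr0n.
apply: (mulIf (_ : ((Num.sqrt (d%:R : R))%:C%C)^-1 != 0)); first by rewrite invr_eq0.
rewrite [RHS]mulrAC divff // mul1r -gauss_sum2; apply/eqP; rewrite -subr_eq0; apply/eqP.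
apply: eq0_normc; apply/eqP; rewrite eq_le; apply/andP; split; last first.
  by case: (_ - _) => a b /=; exact: sqrtr_ge0.
set x := _ / _; set y := _ / _.
have H (T : nat) : (0 < T)%N -> normc (x - y) <= 18 / T%:R.
  move=> T0; have h1 := HJ d T od d0 T0; have h2 := HJ 2%N T isT isT T0.
  have -> : x - y = (x - J T) - (y - J T) by ring.
  apply: (le_trans (le_normcD _ _)); rewrite normcN.
  move: h1 h2; rewrite -/x -/y; lra.
rewrite leNgt; apply/negP => n0.
pose T := (Num.truncn (18 / normc (x - y))).+1.
have := H T isT; rewrite ler_pdivlMr ?ltr0n // mulrC -ler_pdivlMr //.
by rewrite leNgt Num.Theory.truncnS_gt.
Qed.

End GaussSumValue.

(** * Gauss sums of quadratic functions on a finite abelian group *)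

Section QuadraticCharacter.
Context {R : realType} {E : finZmodType}.
Implicit Types x y : E.

(** If [chi y0] is not 1, translation by [y0] permutes [B] and multiplies the sum by [chi y0], so
    the sum is 0. *)
Lemma sum_character (chi : E -> R[i]) (B : {pred E}) :
  (forall x y, x \in B -> y \in B -> y - x \in B) ->
  (forall x y, chi (x + y) = chi x * chi y) ->
  \sum_(y in B) chi y = if [forall y in B, chi y == 1] then #|B|%:R else 0.
Proof.
move=> Bsub chiD; case: ifPn => [/forall_inP h|].
  by rewrite (eq_bigr (fun => 1)) ?sumr_const // => y /h/eqP.
rewrite negb_forall_in => /exists_inP[y0 y0B chi0].
have B0 : 0 \in B by rewrite -(subrr y0) Bsub.
have BN : - y0 \in B by rewrite -sub0r Bsub.
apply: (mulfI (x := chi y0 - 1)); first by rewrite subr_eq0.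
rewrite mulr0 mulrBl mul1r mulr_sumr; apply/eqP; rewrite subr_eq0; apply/eqP.
rewrite [RHS](reindex_inj (addrI y0)) /=; apply: eq_big => [y|y _]; last by rewrite chiD.
apply/idP/idP => yB.
  by rewrite addrC -[y0]opprK Bsub.
by rewrite -(addKr y0 y) addrC Bsub.
Qed.

Context (e : E -> R[i]) (psi : E -> E -> R[i]).
Hypothesis eD : forall x y, e (x + y) = e x * e y * psi x y.
Hypothesis psiC : forall x y, psi x y = psi y x.
Hypothesis psiD : forall y x x', psi (x + x') y = psi x y * psi x' y.
Hypothesis e1 : forall x, e x * (e x)^*%C = 1.

Definition perp (B : {pred E}) : {pred E} := [pred x | [forall y in B, psi x y == 1]].

(** Substituting [x + y] for [x] turns [e x * conj (e y)] into [e x * psi x y]; the inner sum over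
    [y] in [B] is then a character sum, which selects the [x] orthogonal to [B]. *)
Lemma gauss_perp (B : {pred E}) :
  (forall x y, x \in B -> y \in B -> y - x \in B) ->
  (\sum_x e x) * (\sum_(y in B) e y)^*%C = #|B|%:R * \sum_(x in perp B) e x.
Proof.
move=> Bsub; rewrite rmorph_sum mulr_sumr.
transitivity (\sum_(y in B) \sum_x e x * psi x y).
  apply: eq_bigr => y _; rewrite mulr_suml (reindex_inj (addIr y)) /=.
  apply: eq_bigr => x _; rewrite eD mulrAC -[e x * _ * _]mulrA.
  by rewrite -mulrA mulrCA -[RHS]mulr1 -(e1 y); ring.
rewrite exchange_big /= mulr_sumr [RHS]big_mkcond /=; apply: eq_bigr => x _.
rewrite -mulr_sumr sum_character //; last by move=> y y'; rewrite !(psiC x) psiD.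
by rewrite inE; case: ifP; rewrite ?mulr0 // mulrC.
Qed.

(** By [gauss_perp] for [B = E], the right side is the order of [E] times that of its radical.
    Summing [psi x y] over [x] in [E] and [y] in [B] in both orders identifies this with the left
    side. *)
Lemma card_perp (B : {pred E}) :
  (forall x y, x \in B -> y \in B -> y - x \in B) ->
  {subset perp E <= B} -> (forall x, x \in perp E -> e x = 1) ->
  #|perp B|%:R * #|B|%:R = (\sum_x e x) * (\sum_x e x)^*%C.
Proof.
move=> Bsub radB erad.
have -> : \sum_x e x = \sum_(x in E) e x by [].
rewrite gauss_perp // (eq_bigr (fun=> 1)) // sumr_const.
transitivity (\sum_x \sum_(y in B) psi x y).
  rewrite -sumr_const mulr_suml [LHS]big_mkcond /=; apply: eq_bigr => x _.
  rewrite sum_character //; last by move=> y y'; rewrite !(psiC x) psiD.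
  by rewrite inE; case: ifP; rewrite ?mul1r.
rewrite exchange_big /= -(sumr_const (perp E)) mulr_sumr [LHS]big_mkcond [RHS]big_mkcond /=.
apply: eq_bigr => y _.
rewrite (sum_character (psi^~ y)) //.
have -> : [forall x in E, psi x y == 1] = (y \in perp E).
  by rewrite inE; apply: eq_forallb => x; rewrite psiC.
have := radB y; case: (y \in perp E) => [->//|_]; first by rewrite mulr1.
by case: ifP.
Qed.

End QuadraticCharacter.

(** * Integral matrices inside rational ones *)

Section IntegralMatrices.
Implicit Types n m p : nat.

Lemma intmxM n m p (A : 'M[int]_(n, m)) (B : 'M[int]_(m, p)) :
  intmx (A *m B) = intmx A *m intmx B.
Proof. exact: (map_mxM intr). Qed.

Lemma intmxD n m (A B : 'M[int]_(n, m)) : intmx (A + B) = intmx A + intmx B.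
Proof. exact: (map_mxD intr). Qed.

Lemma intmxN n m (A : 'M[int]_(n, m)) : intmx (- A) = - intmx A.
Proof. exact: (map_mxN intr). Qed.

Lemma intmx_tr n m (A : 'M[int]_(n, m)) : intmx A^T = (intmx A)^T.
Proof. by apply/matrixP => i j; rewrite !mxE. Qed.

Lemma intmx_delta n m i j : intmx (delta_mx i j : 'M[int]_(n, m)) = delta_mx i j.
Proof. by apply/matrixP => k l; rewrite !mxE; case: (_ && _). Qed.

Lemma det_intmx n (A : 'M[int]_n) : \det (intmx A) = (\det A)%:~R.
Proof. exact: (det_map_mx intr). Qed.

Lemma intmx_unit n (A : 'M[int]_n) : (intmx A \in unitmx) = (\det A != 0).
Proof. by rewrite unitmxE det_intmx unitfE intr_eq0. Qed.

Lemma is_int_mxP n m (X : 'M[rat]_(n, m)) :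
  reflect (exists U, X = intmx U) (is_int_mx X).
Proof.
apply: (iffP forallP) => [h|[U ->] i]; last first.
  by apply/forallP => j; rewrite mxE intr_int.
exists (map_mx Num.floor X); apply/matrixP => i j; rewrite !mxE.
by have /forallP/(_ j)/floorK -> := h i.
Qed.

Lemma is_int_intmx n m (U : 'M[int]_(n, m)) : is_int_mx (intmx U).
Proof. by apply/is_int_mxP; exists U. Qed.

Lemma is_int_mxE n m (X : 'M[rat]_(n, m)) i j : is_int_mx X -> X i j \is a Num.int.
Proof. by move=> /forallP/(_ i)/forallP/(_ j). Qed.

Lemma is_int_mxB n m (X Y : 'M[rat]_(n, m)) :
  is_int_mx X -> is_int_mx Y -> is_int_mx (X - Y).
Proof.
by move=> /is_int_mxP[U ->] /is_int_mxP[V ->]; rewrite -intmxN -intmxD is_int_intmx.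
Qed.

Lemma is_int_mxDr n m (X Y : 'M[rat]_(n, m)) :
  is_int_mx Y -> is_int_mx (X + Y) = is_int_mx X.
Proof.
move=> hY; apply/idP/idP => [h|/is_int_mxP[U ->]]; first by rewrite -(addrK Y X) is_int_mxB.
by case/is_int_mxP: hY => V ->; rewrite -intmxD is_int_intmx.
Qed.

Lemma is_int_mxM n m p (X : 'M[rat]_(n, m)) (Y : 'M[rat]_(m, p)) :
  is_int_mx X -> is_int_mx Y -> is_int_mx (X *m Y).
Proof. by move=> /is_int_mxP[U ->] /is_int_mxP[V ->]; rewrite -intmxM is_int_intmx. Qed.

Lemma is_int_mx_tr n m (X : 'M[rat]_(n, m)) : is_int_mx X^T = is_int_mx X.
Proof.
have tr k l (Y : 'M[rat]_(k, l)) : is_int_mx Y -> is_int_mx Y^T.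
  by move=> /is_int_mxP[U ->]; rewrite -intmx_tr is_int_intmx.
by apply/idP/idP => /tr //; rewrite trmxK.
Qed.

Lemma int_mxtrace n (X : 'M[rat]_n) : is_int_mx X -> \tr X \is a Num.int.
Proof. by move=> h; rewrite rpred_sum // => i _; exact: is_int_mxE. Qed.

(** Multiplication by the integral adjugate turns [A X] into [det A * X]. *)
Lemma det_mul_int_mx n m (A : 'M[int]_n) (X : 'M[rat]_(n, m)) :
  is_int_mx (intmx A *m X) -> is_int_mx ((\det A)%:~R *: X).
Proof.
move=> h; rewrite -det_intmx -mul_scalar_mx -mul_adj_mx -mulmxA.
apply: is_int_mxM => //; rewrite -(map_mx_adj intr); exact: is_int_intmx.
Qed.

End IntegralMatrices.

(** * The tensor form and matrix criteria for the dual lattices *)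

Section TensorForm.
Context {n m : nat} (F : 'M[int]_n) (G : 'M[int]_m).
Hypotheses (Fsym : F^T = F) (Gsym : G^T = G).
Implicit Types X Y Z : 'M[rat]_(n, m).

Lemma tformDl X Y Z : tform F G (X + Y) Z = tform F G X Z + tform F G Y Z.
Proof. by rewrite /tform linearD /= !mulmxDl raddfD. Qed.

Lemma tformC X Y : tform F G X Y = tform F G Y X.
Proof.
rewrite /tform -mxtrace_tr !trmx_mul trmxK -!intmx_tr Fsym Gsym.
by rewrite mxtrace_mulC !mulmxA.
Qed.

Lemma tformDr X Y Z : tform F G X (Y + Z) = tform F G X Y + tform F G X Z.
Proof. by rewrite tformC tformDl !(tformC X). Qed.

Lemma tform_deltar X i j :
  tform F G X (delta_mx i j) = (intmx F *m X *m intmx G) i j.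
Proof.
rewrite tformC /tform trmx_delta -!mulmxA /mxtrace (bigD1 j) //= big1.
  rewrite addr0 mxE (bigD1 i) //= big1 => [|k /negPf ki].
    by rewrite [delta_mx _ _ _ _]mxE !eqxx mul1r addr0.
  by rewrite [delta_mx _ _ _ _]mxE eqxx ki mul0r.
by move=> k /negPf kj; rewrite mxE big1 // => l _; rewrite [delta_mx _ _ _ _]mxE kj mul0r.
Qed.

(** This is Z^#: pairing [X] with the unit matrices reads off the entries of [F X G]. *)
Definition in_dual_tensor X := is_int_mx (intmx F *m X *m intmx G).

Lemma tform_int X U : in_dual_tensor X -> tform F G X (intmx U) \is a Num.int.
Proof.
move=> h; rewrite tformC /tform -!mulmxA; apply: int_mxtrace.
apply: is_int_mxM; first by rewrite -intmx_tr is_int_intmx.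
by rewrite mulmxA.
Qed.

Lemma in_dual_tensorP X :
  (forall U, tform F G X (intmx U) \is a Num.int) -> in_dual_tensor X.
Proof.
move=> h; apply/forallP => i; apply/forallP => j.
by rewrite -tform_deltar -intmx_delta h.
Qed.

Lemma bformE p (A : 'M[int]_p) (x : 'cV[rat]_p) i : A^T = A ->
  bform A x (delta_mx i 0) = (intmx A *m x) i 0.
Proof.
move=> Asym; have -> : intmx A *m x = (x^T *m intmx A)^T.
  by rewrite trmx_mul trmxK -intmx_tr Asym.
by rewrite /bform -colE [LHS]mxE [RHS]mxE.
Qed.

Lemma in_dualV_tens_WE X : in_dualV_tens_W F X = is_int_mx (intmx F *m X).
Proof.
have E i j : bform F (col j X) (delta_mx i 0) = (intmx F *m X) i j.
  by rewrite bformE // colE mulmxA -colE mxE.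
apply/forallP/forallP => h i; apply/forallP => j; have /forallP/(_ i) := h j;
  by rewrite E.
Qed.

Lemma in_V_tens_dualWE X : in_V_tens_dualW G X = is_int_mx (X *m intmx G).
Proof.
have E i j : bform G (row i X)^T (delta_mx j 0) = (X *m intmx G) i j.
  rewrite bformE // -{1}Gsym intmx_tr -trmx_mul mxE rowE -mulmxA -rowE mxE //.
apply/forallP/forallP => h i; apply/forallP => j; have /forallP/(_ j) := h i;
  by rewrite E.
Qed.

End TensorForm.

(** * Mutual orthogonality of V^# (x) W and V (x) W^#, and the discriminant modulo Z *)

Section Duality.
Context {n m : nat} (F : 'M[int]_n) (G : 'M[int]_m).
Hypotheses (Fsym : F^T = F) (Gsym : G^T = G).
Hypotheses (Fnd : \det F != 0) (Gnd : \det G != 0).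
Implicit Types X Y : 'M[rat]_(n, m).

(** By symmetry of [F], the pairing is the trace of [(F X)^T (Y G)], a product of two integral
    matrices. *)
Lemma tform_dual_int X Y :
  is_int_mx (intmx F *m X) -> is_int_mx (Y *m intmx G) -> tform F G X Y \is a Num.int.
Proof.
move=> hX hY; rewrite /tform -mulmxA; apply: int_mxtrace; apply: is_int_mxM => //.
by rewrite -is_int_mx_tr trmx_mul trmxK -intmx_tr Fsym.
Qed.

Lemma intmx1 k : intmx 1%:M = 1%:M :> 'M[rat]_k.
Proof. exact: (map_mx1 intr). Qed.

(** The test elements [E_ij G^-1] lie in V (x) W^#, and their pairing with [X] is the entry [(i, j)]
    of [F X], by [tform_deltar] with the identity as second Gram matrix. *)
Lemma dual_V_tens_dualW X :
  (forall Y, is_int_mx (Y *m intmx G) -> tform F G X Y \is a Num.int) ->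
  is_int_mx (intmx F *m X).
Proof.
move=> h; apply/forallP => i; apply/forallP => j.
have Gu : intmx G \in unitmx by rewrite intmx_unit.
have := h (delta_mx i j *m invmx (intmx G)); rewrite mulmxKV // -{1}intmx_delta is_int_intmx.
move=> /(_ isT); rewrite /tform -!mulmxA mulVmx // mulmxA.
have := @tform_deltar n m F 1%:M Fsym (trmx1 _ _) X i j.
by rewrite /tform intmx1 !mulmx1 ?mulmxA => ->.
Qed.

Lemma dual_dualV_tens_W X :
  (forall Y, is_int_mx (intmx F *m Y) -> tform F G X Y \is a Num.int) ->
  is_int_mx (X *m intmx G).
Proof.
move=> h; apply/forallP => i; apply/forallP => j.
have Fu : intmx F \in unitmx by rewrite intmx_unit.
have := h (invmx (intmx F) *m delta_mx i j); rewrite mulKVmx // -{1}intmx_delta is_int_intmx.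
move=> /(_ isT); rewrite /tform -!mulmxA (mulmxA (intmx F)) mulmxV // mul1mx.
have := @tform_deltar n m 1%:M G (trmx1 _ _) Gsym X i j.
by rewrite /tform intmx1 !mulmx1 mul1mx ?mulmxA => ->.
Qed.

Lemma in_dual_tensor_V X : is_int_mx (intmx F *m X) -> in_dual_tensor F G X.
Proof. by move=> h; apply: is_int_mxM => //; exact: is_int_intmx. Qed.

Lemma in_dual_tensor_W X : is_int_mx (X *m intmx G) -> in_dual_tensor F G X.
Proof. by move=> h; rewrite /in_dual_tensor -mulmxA is_int_mxM // is_int_intmx. Qed.

Lemma denom_gt0 : (0 < denom F G)%N.
Proof. by rewrite /denom absz_gt0 mulf_neq0. Qed.

Lemma is_int_mxZ k l (c : int) (X : 'M[rat]_(k, l)) : is_int_mx X -> is_int_mx (c%:~R *: X).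
Proof.
move=> /is_int_mxP[U ->]; apply/is_int_mxP; exists (c *: U).
by apply/matrixP => i j; rewrite !mxE rmorphM.
Qed.

Lemma denom_scale X (c : int) : is_int_mx (c%:~R *: X) -> (c %| \det F * \det G)%Z ->
  is_int_mx ((denom F G)%:R *: X).
Proof.
move=> h /dvdzP[q qE].
(* The sign turns the product of determinants into its absolute value. *)
have -> : (denom F G)%:R = (sgz (\det F * \det G) * q)%:~R * c%:~R :> rat.
  by rewrite -intrM -mulrA -qE -abszEsg pmulrn.
by rewrite -scalerA is_int_mxZ.
Qed.

Lemma denom_V X : is_int_mx (intmx F *m X) -> is_int_mx ((denom F G)%:R *: X).
Proof. by move=> /det_mul_int_mx/denom_scale; apply; rewrite dvdz_mulr. Qed.

Lemma denom_W X : is_int_mx (X *m intmx G) -> is_int_mx ((denom F G)%:R *: X).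
Proof.
rewrite -is_int_mx_tr trmx_mul -intmx_tr Gsym => /det_mul_int_mx.
by rewrite -linearZ is_int_mx_tr => /denom_scale; apply; rewrite dvdz_mull.
Qed.

Context (z : 'M[rat]_(n, m)) (hz : is_Wu_class F G z).

Lemma phiD X Y : phi F G z (X + Y) = phi F G z X + phi F G z Y + tform F G X Y.
Proof.
by rewrite /phi !tformDl !tformDr // (tformC F G Fsym Gsym Y X); field.
Qed.

(** The Wu property says that [phi] is integral on Z, and an element of Z^# pairs integrally with Z;
    so [phi] descends to Z^#/Z. *)
Lemma phi_shift X U :
  in_dual_tensor F G X -> phi F G z (X + intmx U) - phi F G z X \is a Num.int.
Proof.
move=> h.
have -> : phi F G z (X + intmx U) - phi F G z X =
  phi F G z (intmx U) + tform F G X (intmx U) by rewrite phiD; ring.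
by apply: rpredD; [exact: hz|exact: tform_int].
Qed.

End Duality.

(** * Exponentials of rational arguments *)

Section Expi2piRat.
Context {R : realType}.

Lemma expi2pi_ratr_int (q : rat) : q \is a Num.int -> expi2pi (ratr q : R) = 1.
Proof. by move=> /intrP[k ->]; rewrite ratr_int expi2pi_int. Qed.

Lemma expi2pi_ratr_eq1 (q : rat) : (expi2pi (ratr q : R) == 1) = (q \is a Num.int).
Proof.
apply/eqP/idP => [/expi2pi_eq1[k qk]|]; last exact: expi2pi_ratr_int.
apply/intrP; exists k; apply: (fmorph_inj (@ratr R)).
by rewrite /= qk ratr_int.
Qed.

Lemma expi2pi_ratrD (p q : rat) :
  expi2pi (ratr (p + q) : R) = expi2pi (ratr p) * expi2pi (ratr q).
Proof. by rewrite rmorphD expi2piD. Qed.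

Lemma expi2pi_ratr_cong (p q : rat) :
  p - q \is a Num.int -> expi2pi (ratr p : R) = expi2pi (ratr q).
Proof. by move=> h; rewrite -{1}(subrK q p) expi2pi_ratrD expi2pi_ratr_int // mul1r. Qed.

End Expi2piRat.

(** * From sums over a covering finite group to sums over coset representatives *)

Section CosetSums.
Context {n m : nat}.
Implicit Types X Y : 'M[rat]_(n, m).

Lemma frac_mx_inj_mod (D : nat) (K L : 'M['I_D]_(n, m)) :
  is_int_mx (frac_mx K - frac_mx L) -> K = L.
Proof.
move=> h; apply/matrixP => i j; apply/val_inj => /=.
have D0 : (0 < D)%N by case: (K i j) => k /=; lia.
have /intrP[c] := is_int_mxE _ _ _ i j h; rewrite !mxE -mulrBl => /(congr1 ( *%R^~ D%:R)).
rewrite mulfVK ?pnatr_eq0 -?lt0n // => E.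
have {}E : (K i j)%:Z - (L i j)%:Z = c * D%:Z.
  by apply: (@intr_inj rat); rewrite intrM intrB.
have := ltn_ord (K i j); have := ltn_ord (L i j).
move: E; move: (nat_of_ord (K i j)) (nat_of_ord (L i j)) => k l E lD kD.
(* Two numbers in [[0, D)] cannot differ by a nonzero multiple of [D]. *)
have [c0|[c1|c1]] : c = 0 \/ (1 <= c) \/ (c <= -1) by lia.
- by move: E; rewrite c0 mul0r; lia.
- have : D%:Z <= c * D%:Z by rewrite ler_peMl.
  lia.
- have : c * D%:Z <= - D%:Z by rewrite -mulN1r ler_wpM2r.
  lia.
Qed.

Lemma frac_mx_ex (D : nat) X : (0 < D)%N -> is_int_mx (D%:R *: X) ->
  exists K : 'M['I_D]_(n, m), is_int_mx (X - frac_mx K).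
Proof.
case: D => // D _ /is_int_mxP[C hC].
have DZ : (D.+1%:Z != 0) by [].
exists (\matrix_(i, j) inord `|(C i j %% D.+1)%Z|%N).
apply/is_int_mxP; exists (\matrix_(i, j) (C i j %/ D.+1)%Z).
apply/matrixP => i j; rewrite !mxE inordK; last first.
  by rewrite -ltz_nat gez0_abs ?modz_ge0 // ltz_pmod.
apply: (mulfI (x := D.+1%:R)); first by rewrite pnatr_eq0.
have /matrixP/(_ i j) := hC; rewrite !mxE mulrBr => ->.
rewrite mulrCA divff ?pnatr_eq0 // mulr1.
have -> : `|(C i j %% D.+1)%Z|%N%:R = (C i j %% D.+1)%Z%:~R :> rat.
  by rewrite -{2}(gez0_abs (modz_ge0 (C i j) DZ)).
by rewrite {1}(divz_eq (C i j) D.+1) intrD intrM addrK mulrC.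
Qed.

Context {R : realType} {E : finZmodType} (x : E -> 'M[rat]_(n, m)).
Hypothesis xD : forall k l, is_int_mx (x (k + l) - (x k + x l)).

(** Modulo Z the map [x] is a homomorphism meeting every class of [inD], so its fibres over the
    representatives are translates of the kernel and all have the same size. *)
Lemma sum_coset_reps (D : nat) (inL inD : 'M[rat]_(n, m) -> bool)
    (w : 'M[rat]_(n, m) -> R[i]) :
  (0 < D)%N ->
  (forall X, inD X -> exists k, is_int_mx (x k - X)) ->
  (forall X, inL X -> inD X) ->
  (forall X, inL X -> is_int_mx (D%:R *: X)) ->
  (forall X Y, is_int_mx (X - Y) -> inL X -> inL Y) ->
  (forall X Y, is_int_mx (X - Y) -> inL X -> w X = w Y) ->
  \sum_(k | inL (x k)) w (x k) =
  #|[pred k | is_int_mx (x k)]|%:R * \sum_(X <- coset_reps D inL) w X.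
Proof.
move=> D0 xsurj LD Lden Lmod wmod.
have isN X Y : is_int_mx (X - Y) -> is_int_mx (Y - X).
  by move=> /is_int_mxP[U h]; rewrite -opprB h -intmxN is_int_intmx.
rewrite /coset_reps big_filter big_map big_enum_cond /= mulr_sumr.
transitivity (\sum_(k | inL (x k)) \sum_(K : 'M['I_D]_(n, m) | is_int_mx (x k - frac_mx K))
    w (x k)).
  apply: eq_bigr => k hk; have [K hK] := frac_mx_ex _ _ D0 (Lden _ hk).
  rewrite (big_pred1 K) // => L; apply/idP/eqP => [hL|->//].
  apply: frac_mx_inj_mod.
  have -> : frac_mx L - frac_mx K = (x k - frac_mx K) - (x k - frac_mx L).
    by apply/matrixP => i j; rewrite !mxE; ring.
  exact: is_int_mxB.
rewrite (exchange_big_dep (fun K => inL (frac_mx K))) /=; last first.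
  by move=> k K hk hK; exact: Lmod hK hk.
apply: eq_bigr => K hK.
transitivity (\sum_(k in [pred k | is_int_mx (x k - frac_mx K)]) w (frac_mx K)).
  apply: eq_big => [k|k /andP[hk hk']]; last exact: wmod hk' hk.
  by apply: andb_idl => h; exact: Lmod (isN _ _ h) hK.
rewrite sumr_const -[RHS]mulrC mulr_natr; congr (_ *+ _).
(* Translation by a point [k0] of the fibre identifies the kernel with the fibre. *)
have [k0 hk0] := xsurj _ (LD _ hK).
rewrite -!sum1_card [LHS](reindex_inj (addIr k0)); apply: eq_bigl => k; rewrite !inE.
have -> : x (k + k0) - frac_mx K =
   x k + ((x (k + k0) - (x k + x k0)) + (x k0 - frac_mx K)).
  by rewrite opprD !addrA; apply/matrixP => i j; rewrite !mxE; ring.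
rewrite is_int_mxDr //; rewrite is_int_mxDr //.
Qed.

End CosetSums.

(** * Product decomposition and signed, shifted one-dimensional sums *)

Section DiagonalSums.
Context {R : realType}.

Lemma sum_matrix_prod (n m : nat) (T : finType) (f : 'I_n -> 'I_m -> T -> R[i]) :
  \sum_(k : 'M[T]_(n, m)) \prod_i \prod_j f i j (k i j) =
  \prod_i \prod_j \sum_t f i j t.
Proof.
rewrite [RHS]pair_bigA /= bigA_distr_bigA /=.
rewrite (reindex (fun g : {ffun 'I_n * 'I_m -> T} => \matrix_(i, j) g (i, j))) /=.
  apply: eq_bigr => g _; rewrite pair_bigA /=; apply: eq_bigr => -[i j] _.
  by rewrite mxE.
exists (fun k : 'M[T]_(n, m) => [ffun ij => k ij.1 ij.2]) => [g _|k _].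
  by apply/ffunP => -[i j]; rewrite ffunE mxE.
by apply/matrixP => i j; rewrite mxE ffunE.
Qed.

Lemma conjc_realM (x : R) (w : R[i]) : (x%:C%C * w)^*%C = x%:C%C * w^*%C.
Proof. by rewrite rmorphM /=; congr (_ * _); rewrite oppr0. Qed.

Definition sqr_char (d k : int) : R[i] := expi2pi (ratr ((k ^+ 2)%:~R / (2 * d%:~R))).

(** Writing [k = l + q d] and [d = 2 h], the exponents differ by the integer [l q + q^2 h]. *)
Lemma sqr_char_mod (d k l : int) : d != 0 -> (2 %| d)%Z -> (d %| k - l)%Z ->
  sqr_char d k = sqr_char d l.
Proof.
move=> d0 /dvdzP[h dE] /dvdzP[q klE]; apply: expi2pi_ratr_cong.
have -> : k = l + q * d by rewrite -klE; ring.
have -> : ((l + q * d) ^+ 2)%:~R / (2 * d%:~R) - (l ^+ 2)%:~R / (2 * d%:~R) =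
   (l * q + q ^+ 2 * h)%:~R :> rat.
  have h0 : (h%:~R : rat) != 0.
    by rewrite intr_eq0; apply: contraNneq d0 => h0; rewrite dE h0 mul0r.
  by rewrite dE !(rmorphD, rmorphM, rmorphXn) /=; field.
exact: intr_int.
Qed.

(** A negative [d] conjugates the sum for [|d|], so the phase carries the sign of [d]; these signs
    later add up to the signature. *)
Lemma sum_sqr_char_full (d : int) : d != 0 -> (2 %| d)%Z ->
  \sum_(0 <= u < `|d|) sqr_char d u%:Z =
  (Num.sqrt (`|d|%N%:R : R))%:C%C * expi (pi / 4 * (sgz d)%:~R).
Proof.
move=> d0 d2; have dn0 : (0 < `|d|)%N by rewrite absz_gt0.
have od : ~~ odd `|d| by rewrite -dvdn2; exact: d2.
have gE u : gterm `|d| u = expi2pi (ratr ((u%:Z ^+ 2)%:~R / (2 * `|d|%:~R)) : R).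
  rewrite /gterm; congr expi2pi; rewrite fmorph_div /=.
  have -> : ratr (2 * `|d|%:~R) = 2 * `|d|%N%:R :> R.
    by rewrite rmorphM /= ratr_nat ratr_int natr_absz.
  by rewrite ratr_int rmorphXn.
have := gauss_sum_value (R := R) `|d| od dn0; rewrite /gauss_sum.
have [dneg|dpos] := ltP d 0; last first.
  have dgt : 0 < d by rewrite lt_neqAle eq_sym d0.
  rewrite gtr0_sgz // mulr1 => <-; apply: eq_bigr => u _; rewrite gE.
  by rewrite (ger0_norm dpos).
rewrite ltr0_sgz // mulrN1 -conjc_expi => /(congr1 (@conjc R)).
rewrite conjc_realM => <-; rewrite rmorph_sum; apply: eq_bigr => u _.
rewrite gE; apply: (etrans _ (esym (conjc_expi2pi _))).
rewrite -rmorphN (ltr0_norm dneg); congr (expi2pi (ratr _)).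
by rewrite mulrNz; field; rewrite intr_eq0.
Qed.

(** Translating by the residue of [c] removes the shift; what remains is [(p + 1) / |d|] full
    periods, each of modulus [sqrt |d|]. *)
Lemma sum_sqr_char_shift (p : nat) (d c : int) :
  d != 0 -> (2 %| d)%Z -> (d %| p.+1%:Z)%Z ->
  \sum_(x : 'I_p.+1) sqr_char d ((x : nat)%:Z - c) =
  ((p.+1%:R / Num.sqrt (`|d|%N%:R : R)))%:C%C * expi (pi / 4 * (sgz d)%:~R).
Proof.
move=> d0 d2 dp.
pose y0 : 'I_p.+1 := inord `|(c %% p.+1)%Z|%N.
have y0E : (y0 : nat)%:Z = (c %% p.+1)%Z.
  rewrite /y0 inordK ?gez0_abs ?modz_ge0 //.
  by rewrite -ltz_nat gez0_abs ?modz_ge0 // ltz_pmod.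
rewrite (reindex_inj (addIr y0)) /=.
transitivity (\sum_(x : 'I_p.+1) sqr_char d (x : nat)%:Z).
  apply: eq_bigr => x _; apply: sqr_char_mod => //.
  apply: (dvdz_trans dp); apply/dvdzP.
  (* The witness collects the wrap-around of addition modulo [p + 1] and the quotient of [c] by
     [p + 1]. *)
  exists (- (((x + y0) %/ p.+1)%N%:Z + (c %/ p.+1)%Z)).
  have h1 : (x + y0)%N%:Z = ((x + y0) %/ p.+1)%N%:Z * p.+1%:Z + ((x + y0) %% p.+1)%N%:Z.
    by rewrite -PoszM -PoszD -divn_eq.
  have h2 := divz_eq c p.+1; rewrite -y0E in h2.
  rewrite PoszD in h1; rewrite /= {1}h2 mulNr mulrDl.
  move: h1; move: (_ * p.+1%:Z) ((x + y0) %% p.+1)%N%:Z => u v h1.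
  have -> : v = x%:Z + y0%:Z - u by rewrite h1; ring.
  ring.
rewrite -(big_mkord xpredT (fun x => sqr_char d x%:Z)).
have dp' : (`|d| %| p.+1)%N by exact: dp.
have dn0 : (0 < `|d|)%N by rewrite absz_gt0.
rewrite -{1}(divnK dp') sum_nat_blocks.
transitivity (\sum_(0 <= v < p.+1 %/ `|d|) \sum_(0 <= u < `|d|) sqr_char d u%:Z).
  apply: eq_bigr => v _; apply: eq_bigr => u _; apply: sqr_char_mod => //.
  by rewrite PoszD PoszM addrK dvdz_mull // dvdzE /=.
rewrite sumr_const_nat subn0 sum_sqr_char_full // -[LHS]mulr_natl mulrA.
congr (_ * _); rewrite -(rmorph_nat (real_complex R)) -rmorphM; congr (_%:C)%C.
have s0 : 0 < Num.sqrt (`|d|%N%:R : R) by rewrite sqrtr_gt0 ltr0n.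
have sE : Num.sqrt `|d|%N%:R ^+ 2 = `|d|%N%:R :> R by rewrite sqr_sqrtr.
have pE : p.+1%:R = (p.+1 %/ `|d|)%:R * Num.sqrt `|d|%N%:R ^+ 2 :> R.
  by rewrite sE -natrM divnK.
by rewrite pE; field; rewrite gt_eqF.
Qed.

End DiagonalSums.

(** * Integral diagonalization of a Gram matrix, with its signature *)

Section Signature.

Lemma int_scale_mx (n m : nat) (X : 'M[rat]_(n, m)) :
  exists2 l : int, 0 < l & is_int_mx (l%:~R *: X).
Proof.
pose l := \prod_(ij : 'I_n * 'I_m) denq (X ij.1 ij.2).
exists l; first by apply: prodr_gt0 => ij _; exact: denq_gt0.
apply/forallP => i; apply/forallP => j; rewrite mxE /l (bigD1 (i, j)) //= rmorphM /=.
by rewrite mulrAC [_ * X i j]mulrC -numqE rpredM // intr_int.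
Qed.

Lemma card_pos_neg_sgz (n : nat) (d : 'I_n -> rat) :
  #|[set i | 0 < d i]|%:Z - #|[set i | d i < 0]|%:Z = \sum_i sgz (d i).
Proof.
rewrite -!natz -!sumr_const.
rewrite (big_mkcond (fun i => i \in [set i | 0 < d i])).
rewrite (big_mkcond (fun i => i \in [set i | d i < 0])) /= -sumrB.
by apply: eq_bigr => i _; rewrite !inE; case: sgzP.
Qed.

(* The factor 2 in [P + P] makes the diagonal entries even. *)
Lemma signature_int_diag (n : nat) (F : 'M[int]_n) (s : int) :
  \det F != 0 -> is_signature (intmx F) s ->
  exists (P : 'M[int]_n) (a : 'rV[int]_n),
    [/\ \det (P + P) != 0, (P + P)^T *m F *m (P + P) = diag_mx a,
        forall i, a 0 i != 0, forall i, (2 %| a 0%R i)%Z & s = \sum_i sgz (a 0 i)].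
Proof.
move=> Fnd [P0 [P0u P0d ->]]; have [l l0 /is_int_mxP[P hP]] := int_scale_mx _ _ P0.
pose A := (P + P)^T *m F *m (P + P).
(* Clearing denominators and doubling scale the diagonal by the positive square [c], which preserves
   all signs. *)
pose c : rat := (l + l)%:~R ^+ 2.
have c0 : 0 < c by rewrite exprn_gt0 // ltr0z addr_gt0.
have hPP : intmx (P + P) = (l + l)%:~R *: P0 by rewrite intmxD -hP -scalerDl -rmorphD.
have hA : intmx A = c *: (P0^T *m intmx F *m P0).
  by rewrite /A !intmxM intmx_tr hPP !linearZ /= -!scalemxAl scalerA.
have Pnd : \det (P + P) != 0.
  rewrite -intmx_unit hPP unitmxZ // unitfE intr_eq0 gt_eqF // addr_gt0 //.
exists P, (\row_i A i i).
have Ad : A = diag_mx (\row_i A i i).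
  apply/matrixP => i j; rewrite !mxE; have [->|ij] := eqVneq i j; first by rewrite mulr1n.
  rewrite mulr0n; apply: (@intr_inj rat).
  have /matrixP/(_ i j) := hA; rewrite !mxE => ->.
  by move: P0d => /is_diag_mxP/(_ i j ij); rewrite !mxE => ->; rewrite mulr0.
have And : \det A != 0 by rewrite !det_mulmx det_tr !mulf_neq0.
split=> //.
- by move=> i; move: And; rewrite {1}Ad det_diag => /prodf_neq0/(_ i isT).
- move=> i; rewrite mxE /A mulmxDr mxE; move: (_ *m P) => M.
  by apply/dvdzP; exists (M i i); ring.
rewrite card_pos_neg_sgz; apply: eq_bigr => i _; rewrite [in RHS]mxE.
have h : (A i i)%:~R = c * (P0^T *m intmx F *m P0) i i :> rat.
  by have /matrixP/(_ i i) := hA; rewrite [LHS]mxE [RHS]mxE.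
by rewrite -[RHS](sgz_int rat) h sgzM (gtr0_sgz c0) mul1r.
Qed.

End Signature.

(** * Reciprocity in the discriminant group of a diagonal sublattice *)

Section DiagonalSublattice.
Context {R : realType} {n m : nat} (F : 'M[int]_n) (G : 'M[int]_m).
Hypotheses (Fsym : F^T = F) (Gsym : G^T = G).
Hypotheses (Fnd : \det F != 0) (Gnd : \det G != 0).
Context (P : 'M[int]_n) (Q : 'M[int]_m) (a : 'rV[int]_n) (b : 'rV[int]_m).
Hypotheses (Pnd : \det P != 0) (Qnd : \det Q != 0).
Hypotheses (Pdiag : P^T *m F *m P = diag_mx a) (Qdiag : Q^T *m G *m Q = diag_mx b).
Hypotheses (a0 : forall i, a 0 i != 0) (b0 : forall j, b 0 j != 0).
Hypothesis a2 : forall i, (2 %| a 0%R i)%Z.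
Implicit Types (k l : 'M[int]_(n, m)) (Y : 'M[rat]_(n, m)).

(** The value of f (x) g on the basis vector [P e_i (x) Q e_j] paired with itself. *)
Definition dcoef (i : 'I_n) (j : 'I_m) : int := a 0 i * b 0 j.

(* [tobasis Y] has coordinates [Y] in the orthogonal basis [P e_i (x) Q e_j],
   and [todual k] has coordinates [k] in its dual basis. *)
Definition tobasis Y : 'M[rat]_(n, m) := intmx P *m Y *m (intmx Q)^T.
Definition todual k : 'M[rat]_(n, m) :=
  tobasis (\matrix_(i, j) ((k i j)%:~R / (dcoef i j)%:~R)).

Lemma dcoef_neq0 i j : dcoef i j != 0.
Proof. by rewrite mulf_neq0. Qed.

Lemma dcoefR_neq0 i j : (dcoef i j)%:~R != 0 :> rat.
Proof. by rewrite intr_eq0 dcoef_neq0. Qed.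

Lemma dcoef2 i j : (2 %| dcoef i j)%Z.
Proof. exact: dvdz_mulr. Qed.

Lemma tobasisD Y Y' : tobasis (Y + Y') = tobasis Y + tobasis Y'.
Proof. by rewrite /tobasis mulmxDr mulmxDl. Qed.

Lemma tobasis_int k : tobasis (intmx k) = intmx (P *m k *m Q^T).
Proof. by rewrite !intmxM intmx_tr. Qed.

Lemma todualD k l : todual (k + l) = todual k + todual l.
Proof.
rewrite /todual -tobasisD; congr tobasis; apply/matrixP => i j.
by rewrite !mxE rmorphD mulrDl.
Qed.

Lemma tform_tobasis Y Y' : tform F G (tobasis Y) (tobasis Y') =
  \sum_i \sum_j (dcoef i j)%:~R * Y i j * Y' i j.
Proof.
rewrite /tform /tobasis !trmx_mul trmxK -!mulmxA mxtrace_mulC -!mulmxA.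
have EQ : (intmx Q)^T *m (intmx G *m intmx Q) = intmx (diag_mx b).
  by rewrite -intmx_tr -Qdiag !intmxM mulmxA.
have EP : (intmx P)^T *m (intmx F *m (intmx P *m (Y' *m intmx (diag_mx b)))) =
    intmx (diag_mx a) *m (Y' *m intmx (diag_mx b)).
  by rewrite -Pdiag !intmxM intmx_tr !mulmxA.
rewrite EQ EP /mxtrace exchange_big /=; apply: eq_bigr => j _.
rewrite mxE; apply: eq_bigr => i _.
have dE p (c : 'rV[int]_p) : intmx (diag_mx c) = diag_mx (intmx c).
  by apply/matrixP => u v; rewrite !mxE; case: (u == v).
by rewrite !dE mul_diag_mx mul_mx_diag !mxE /dcoef rmorphM; ring.
Qed.

Lemma tform_todual_tobasis k Y :
  tform F G (todual k) (tobasis Y) = \sum_i \sum_j (k i j)%:~R * Y i j.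
Proof.
rewrite tform_tobasis; apply: eq_bigr => i _; apply: eq_bigr => j _.
by rewrite mxE; field; exact: dcoefR_neq0.
Qed.

Lemma tform_todual_int k l :
  tform F G (todual k) (tobasis (intmx l)) \is a Num.int.
Proof.
rewrite tform_todual_tobasis; apply: rpred_sum => i _; apply: rpred_sum => j _.
by rewrite mxE rpredM // intr_int.
Qed.

Lemma tform_todual k l : tform F G (todual k) (todual l) =
  \sum_i \sum_j (k i j * l i j)%:~R / (dcoef i j)%:~R.
Proof.
rewrite tform_todual_tobasis; apply: eq_bigr => i _; apply: eq_bigr => j _.
by rewrite mxE [(k i j * _)%:~R]intrM mulrA.
Qed.

Lemma tobasis_surj (X : 'M[rat]_(n, m)) : exists Y, X = tobasis Y.
Proof.
have Pu : intmx P \in unitmx by rewrite intmx_unit.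
have Qu : (intmx Q)^T \in unitmx by rewrite unitmx_tr intmx_unit.
exists (invmx (intmx P) *m X *m invmx ((intmx Q)^T)).
by rewrite /tobasis !mulmxA mulmxV // mul1mx mulmxKV.
Qed.

Lemma tform_tobasis_delta Y i j :
  tform F G (tobasis Y) (tobasis (delta_mx i j)) = (dcoef i j)%:~R * Y i j.
Proof.
rewrite tform_tobasis (bigD1 i) //= (bigD1 j) //= mxE !eqxx mulr1.
rewrite big1 => [|j' /negPf jj]; last by rewrite mxE jj andbF mulr0.
rewrite big1 ?addr0 // => i' /negPf ii; apply: big1 => j' _.
by rewrite mxE ii mulr0.
Qed.

Lemma todual_eq (X : 'M[rat]_(n, m)) k :
  (forall i j, tform F G X (tobasis (delta_mx i j)) = (k i j)%:~R) -> X = todual k.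
Proof.
have [Y ->] := tobasis_surj X => h; congr tobasis; apply/matrixP => i j.
rewrite mxE -h tform_tobasis_delta mulrC mulKf //; exact: dcoefR_neq0.
Qed.

Lemma tform_basis_int (X : 'M[rat]_(n, m)) i j : in_dual_tensor F G X ->
  tform F G X (tobasis (delta_mx i j)) \is a Num.int.
Proof. by move=> h; rewrite -intmx_delta tobasis_int; apply: tform_int. Qed.

(** The diagonal sublattice is contained in Z, so its dual contains Z^#; pairing with the basis
    gives the dual coordinates. *)
Lemma in_dual_tensor_todual (X : 'M[rat]_(n, m)) :
  in_dual_tensor F G X -> exists k, X = todual k.
Proof.
move=> h; exists (\matrix_(i, j) Num.floor (tform F G X (tobasis (delta_mx i j)))).
by apply: todual_eq => i j; rewrite mxE floorK // tform_basis_int.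
Qed.

Context (p : nat) (dp : forall i j, (dcoef i j %| p.+1%:Z)%Z).
Notation E := 'M['I_p.+1]_(n, m).

(* Since every [dcoef i j] divides [p + 1], [lat] induces a surjection of [E]
   onto the discriminant group of the lattice spanned by [P e_i (x) Q e_j];
   its kernel is the radical of [bchar] below. *)
Definition lift_mx (x : E) : 'M[int]_(n, m) := map_mx (fun t : 'I_p.+1 => (t : nat)%:Z) x.
Definition lat (x : E) : 'M[rat]_(n, m) := todual (lift_mx x).

(** Since each [dcoef i j] divides [p + 1], reducing dual coordinates modulo [p + 1] changes the
    vector only by the sublattice. *)
Lemma todual_period k : exists l, todual (p.+1%:Z *: k) = tobasis (intmx l).
Proof.
exists (\matrix_(i, j) ((p.+1%:Z %/ dcoef i j)%Z * k i j)); congr tobasis.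
apply/matrixP => i j; rewrite !mxE; move: (dcoef i j) (dcoefR_neq0 i j) (dp i j).
move=> d d0 dvd; rewrite -{1}(divzK dvd) !intrM; field; exact: d0.
Qed.

Lemma latD x y : exists l, lat (x + y) = lat x + lat y + tobasis (intmx l).
Proof.
have [l hl] := todual_period (- \matrix_(i, j) ((x i j + y i j) %/ p.+1)%N%:Z).
exists l; rewrite -hl -!todualD; congr todual; apply/matrixP => i j; rewrite !mxE /=.
have h : (x i j + y i j)%N%:Z = ((x i j + y i j) %/ p.+1)%N%:Z * p.+1%:Z
    + ((x i j + y i j) %% p.+1)%N%:Z.
  by rewrite -PoszM -PoszD -divn_eq.
by rewrite -PoszD h; ring.
Qed.

Lemma lat_surj k : exists x l, lat x = todual k + tobasis (intmx l).
Proof.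
have [l hl] := todual_period (- \matrix_(i, j) (k i j %/ p.+1)%Z).
exists (\matrix_(i, j) inord `|(k i j %% p.+1)%Z|%N), l.
rewrite -hl -!todualD; congr todual; apply/matrixP => i j; rewrite !mxE.
rewrite inordK; last by rewrite -ltz_nat gez0_abs ?modz_ge0 // ltz_pmod.
by rewrite gez0_abs ?modz_ge0 // {2}(divz_eq (k i j) p.+1); ring.
Qed.

Lemma lat_addB x y : is_int_mx (lat (x + y) - (lat x + lat y)).
Proof.
by have [l ->] := latD x y; rewrite addrAC subrr add0r tobasis_int is_int_intmx.
Qed.

Lemma lat_surj_dual (X : 'M[rat]_(n, m)) :
  in_dual_tensor F G X -> exists x, is_int_mx (lat x - X).
Proof.
move=> /in_dual_tensor_todual[k ->]; have [x [l hx]] := lat_surj k.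
by exists x; rewrite hx addrAC subrr add0r tobasis_int is_int_intmx.
Qed.

Context (z : 'M[rat]_(n, m)) (hz : is_Wu_class F G z).

Definition qchar (x : E) : R[i] := expi2pi (ratr (phi F G z (lat x))).
Definition bchar (x y : E) : R[i] := expi2pi (ratr (tform F G (lat x) (lat y))).

Lemma qcharD x y : qchar (x + y) = qchar x * qchar y * bchar x y.
Proof.
rewrite /qchar /bchar -!expi2pi_ratrD -phiD //; apply: expi2pi_ratr_cong.
have [l ->] := latD x y; rewrite phiD //.
have -> (u v w : rat) : u + v + w - u = v + w by ring.
apply: rpredD; first by rewrite tobasis_int; exact: hz.
by rewrite tformDl; apply: rpredD; exact: tform_todual_int.
Qed.

Lemma bcharC x y : bchar x y = bchar y x.
Proof. by rewrite /bchar tformC. Qed.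

Lemma bcharD y x x' : bchar (x + x') y = bchar x y * bchar x' y.
Proof.
rewrite /bchar -expi2pi_ratrD -tformDl; apply: expi2pi_ratr_cong.
have [l ->] := latD x x'; rewrite tformDl addrAC subrr add0r tformC //.
exact: tform_todual_int.
Qed.

Lemma qchar_conj x : qchar x * (qchar x)^*%C = 1.
Proof. by rewrite /qchar conjc_expi2pi -expi2piD subrr expi2pi0. Qed.

Definition inA (x : E) := is_int_mx (intmx F *m lat x).
Definition inB (x : E) := is_int_mx (lat x *m intmx G).

Lemma inB_sub x y : inB x -> inB y -> inB (y - x).
Proof.
move=> hx hy; rewrite /inB.
have -> : lat (y - x) = (lat y - lat x) - (lat (y - x + x) - (lat (y - x) + lat x)).
  by rewrite subrK; apply/matrixP => i j; rewrite !mxE; ring.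
rewrite !mulmxBl; apply: is_int_mxB; first exact: is_int_mxB.
by rewrite -mulmxBl; apply: is_int_mxM; [exact: lat_addB|exact: is_int_intmx].
Qed.

(** [lat] reaches every element of V (x) W^# modulo the sublattice, so orthogonality inside [E]
    amounts to orthogonality to V (x) W^#, whose complement is V^# (x) W. *)
Lemma perp_inB x : (x \in perp bchar [pred y | inB y]) = inA x.
Proof.
rewrite inE; apply/forall_inP/idP => [h|hA y]; last first.
  by rewrite expi2pi_ratr_eq1 => hB; exact: (tform_dual_int F G Fsym _ _ hA hB).
apply: (dual_V_tens_dualW F G) => // Y hY.
have /in_dual_tensor_todual[k kE] := in_dual_tensor_W F G Y hY.
have [y [l hy]] := lat_surj k.
have hB : inB y.
  rewrite /inB hy -kE mulmxDl is_int_mxDr // tobasis_int -intmxM; exact: is_int_intmx.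
have := h y hB; rewrite expi2pi_ratr_eq1 hy -kE tformDr // => h'.
by rewrite -(rpredDr _ (tform_todual_int (lift_mx x) l)).
Qed.

(** Orthogonality to the dual basis vectors makes the coordinates of [lat y] in the basis integral,
    so [lat y] lies in the sublattice. This supplies both hypotheses of [card_perp] on the
    radical. *)
Lemma rad_int y : y \in perp bchar E -> exists U, lat y = intmx U.
Proof.
rewrite inE => /forall_inP h.
have hd i j : ((lift_mx y i j)%:~R / (dcoef i j)%:~R : rat) \is a Num.int.
  have [x [l hx]] := lat_surj (delta_mx i j).
  have := h x isT; rewrite expi2pi_ratr_eq1 hx tformDr //.
  rewrite (rpredDr _ (tform_todual_int (lift_mx y) l)) tform_todual.
  rewrite (bigD1 i) //= (bigD1 j) //= [delta_mx _ _ _ _]mxE !eqxx mulr1.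
  rewrite big1 => [|j' /negPf jj]; last by rewrite [delta_mx _ _ _ _]mxE jj andbF mulr0 mul0r.
  rewrite big1 ?addr0 // => i' /negPf ii; apply: big1 => j' _.
  by rewrite [delta_mx _ _ _ _]mxE ii mulr0 mul0r.
have /is_int_mxP[V hV] : is_int_mx (\matrix_(i, j) ((lift_mx y i j)%:~R / (dcoef i j)%:~R)).
  by apply/forallP => i; apply/forallP => j; rewrite mxE.
by exists (P *m V *m Q^T); rewrite -tobasis_int -hV.
Qed.

Context (c : 'M[int]_(n, m)) (zE : z = todual (c + c)).

(** Completing the square around [c], half of the dual coordinates of [z]. *)
Lemma phi_todual k : phi F G z (todual k) =
  \sum_i \sum_j (((k i j - c i j) ^+ 2)%:~R / (2 * (dcoef i j)%:~R)
                 - (c i j ^+ 2)%:~R / (2 * (dcoef i j)%:~R)).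
Proof.
rewrite /phi zE !tform_todual -sumrB mulr_suml; apply: eq_bigr => i _.
rewrite -sumrB mulr_suml; apply: eq_bigr => j _; rewrite [(c + c) i j]mxE.
move: (dcoef i j) (dcoefR_neq0 i j) => d d0.
by rewrite !(rmorphM, rmorphD, rmorphB, rmorphXn) /=; field.
Qed.

Lemma tform_zz :
  tform F G z z = 8 * \sum_i \sum_j (c i j ^+ 2)%:~R / (2 * (dcoef i j)%:~R).
Proof.
rewrite zE tform_todual mulr_sumr; apply: eq_bigr => i _.
rewrite mulr_sumr; apply: eq_bigr => j _; rewrite [(c + c) i j]mxE.
move: (dcoef i j) (dcoefR_neq0 i j) => d d0.
by rewrite !(rmorphM, rmorphD, rmorphXn) /=; field.
Qed.

Definition modulus : R := \prod_i \prod_j (p.+1%:R / Num.sqrt (`|dcoef i j|%N%:R : R)).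

Lemma modulus_gt0 : 0 < modulus.
Proof.
apply: prodr_gt0 => i _; apply: prodr_gt0 => j _.
by rewrite divr_gt0 ?ltr0n // sqrtr_gt0 ltr0n absz_gt0 dcoef_neq0.
Qed.

(** The van der Blij and Milgram formula for [E]. The sum factors into shifted one-dimensional sums;
    since [sgz (a_i b_j)] is multiplicative, their phases combine to the product of the two
    signatures, and the constants left by completing the square sum to [-1/8] of the value at
    [(z, z)]. *)
Lemma sum_qchar : \sum_x qchar x = modulus%:C%C *
  expi (pi / 4 * (((\sum_i sgz (a 0 i)) * (\sum_j sgz (b 0 j)))%:~R
                  - ratr (tform F G z z))).
Proof.
pose v i j : R := - ratr ((c i j ^+ 2)%:~R / (2 * (dcoef i j)%:~R)).
have qE x : qchar x = \prod_i \prod_j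
    (sqr_char (dcoef i j) ((x i j : nat)%:Z - c i j) * expi2pi (v i j)).
  rewrite /qchar /lat phi_todual rmorph_sum expi2pi_sum; apply: eq_bigr => i _.
  rewrite rmorph_sum expi2pi_sum; apply: eq_bigr => j _.
  by rewrite rmorphB expi2piD !mxE.
under eq_bigr => x _ do rewrite qE.
rewrite (sum_matrix_prod _ _ _
  (fun i j (t : 'I_p.+1) => sqr_char (dcoef i j) ((t : nat)%:Z - c i j) * expi2pi (v i j))).
transitivity (\prod_i \prod_j ((p.+1%:R / Num.sqrt (`|dcoef i j|%N%:R : R))%:C%C *
    expi (pi / 4 * (sgz (dcoef i j))%:~R + 2 * pi * v i j))).
  apply: eq_bigr => i _; apply: eq_bigr => j _.
  rewrite -mulr_suml sum_sqr_char_shift ?dcoef_neq0 ?dcoef2 ?dp //.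
  by rewrite expiD mulrA.
under eq_bigr => i _ do
  rewrite big_split /= -rmorph_prod -(big_morph (@expi R) expiD expi0).
rewrite big_split /= -rmorph_prod -(big_morph (@expi R) expiD expi0).
congr (_ * expi _).
transitivity (\sum_i \sum_j (pi / 4 * (sgz (a 0 i) * sgz (b 0 j))%:~R) +
   \sum_i \sum_j 2 * pi * v i j).
  rewrite -big_split /=; apply: eq_bigr => i _; rewrite -big_split /=.
  by apply: eq_bigr => j _; rewrite sgzM.
rewrite mulrBr; congr (_ + _).
  rewrite mulr_suml rmorph_sum mulr_sumr; apply: eq_bigr => i _.
  by rewrite mulr_sumr rmorph_sum mulr_sumr.
rewrite tform_zz rmorphM /= ratr_nat.
have -> : \sum_i \sum_j 2 * pi * v i j = 2 * pi * \sum_i \sum_j v i j.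
  by rewrite mulr_sumr; apply: eq_bigr => i _; rewrite mulr_sumr.
have -> : \sum_i \sum_j v i j =
    - ratr (\sum_i \sum_j (c i j ^+ 2)%:~R / (2 * (dcoef i j)%:~R)).
  rewrite rmorph_sum -sumrN; apply: eq_bigr => i _.
  by rewrite rmorph_sum -sumrN.
by move: (ratr _) => t; field.
Qed.

Definition qexp (X : 'M[rat]_(n, m)) : R[i] := expi2pi (ratr (phi F G z X)).

Lemma qexp_mod (X Y : 'M[rat]_(n, m)) :
  is_int_mx (X - Y) -> in_dual_tensor F G Y -> qexp X = qexp Y.
Proof.
move=> /is_int_mxP[U h] hY; apply: expi2pi_ratr_cong.
have -> : X = Y + intmx U by rewrite -h addrC subrK.
exact: phi_shift.
Qed.

Lemma in_dual_tensor_mod (X Y : 'M[rat]_(n, m)) :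
  is_int_mx (X - Y) -> in_dual_tensor F G X -> in_dual_tensor F G Y.
Proof.
move=> h; rewrite /in_dual_tensor -{1}(subrK Y X) [X - Y + Y]addrC.
rewrite mulmxDr mulmxDl is_int_mxDr //.
by apply: is_int_mxM (is_int_intmx _ _ _); apply: is_int_mxM h; exact: is_int_intmx.
Qed.

(** Applied both to the exponential of [phi] and to the constant 1, this yields the Gauss sum and
    the order of V^# (x) W / Z up to the same fibre size. *)
Lemma sum_reps_V (w : 'M[rat]_(n, m) -> R[i]) :
  (forall X Y, is_int_mx (X - Y) -> in_dual_tensor F G Y -> w X = w Y) ->
  \sum_(x | inA x) w (lat x) = #|[pred x | is_int_mx (lat x)]|%:R *
    \sum_(X <- coset_reps (denom F G) (in_dualV_tens_W F)) w X.
Proof.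
move=> wmod.
rewrite -(sum_coset_reps lat lat_addB _ _ (in_dual_tensor F G)).
- by apply: eq_bigl => x; rewrite in_dualV_tens_WE.
- exact: denom_gt0.
- exact: lat_surj_dual.
- by move=> X; rewrite in_dualV_tens_WE //; exact: in_dual_tensor_V.
- by move=> X; rewrite in_dualV_tens_WE //; exact: denom_V.
- move=> X Y h; rewrite !in_dualV_tens_WE // -{1}(subrK Y X) [X - Y + Y]addrC.
  rewrite mulmxDr is_int_mxDr //.
  by apply: is_int_mxM h; exact: is_int_intmx.
- move=> X Y h; rewrite in_dualV_tens_WE // => hX; apply: wmod => //.
  by apply: (in_dual_tensor_mod _ _ h); exact: in_dual_tensor_V.
Qed.

Lemma sum_reps_W (w : 'M[rat]_(n, m) -> R[i]) :
  (forall X Y, is_int_mx (X - Y) -> in_dual_tensor F G Y -> w X = w Y) ->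
  \sum_(x | inB x) w (lat x) = #|[pred x | is_int_mx (lat x)]|%:R *
    \sum_(X <- coset_reps (denom F G) (in_V_tens_dualW G)) w X.
Proof.
move=> wmod.
rewrite -(sum_coset_reps lat lat_addB _ _ (in_dual_tensor F G)).
- by apply: eq_bigl => x; rewrite in_V_tens_dualWE.
- exact: denom_gt0.
- exact: lat_surj_dual.
- by move=> X; rewrite in_V_tens_dualWE //; exact: in_dual_tensor_W.
- by move=> X; rewrite in_V_tens_dualWE //; exact: denom_W.
- move=> X Y h; rewrite !in_V_tens_dualWE // -{1}(subrK Y X) [X - Y + Y]addrC.
  rewrite mulmxDl is_int_mxDr //.
  by apply: is_int_mxM h _; exact: is_int_intmx.
- move=> X Y h; rewrite in_V_tens_dualWE // => hX; apply: wmod => //.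
  by apply: (in_dual_tensor_mod _ _ h); exact: in_dual_tensor_W.
Qed.

Notation SV := (\sum_(X <- coset_reps (denom F G) (in_dualV_tens_W F)) qexp X).
Notation SW := (\sum_(X <- coset_reps (denom F G) (in_V_tens_dualW G)) qexp X).
Notation nV := (size (coset_reps (denom F G) (in_dualV_tens_W F) : seq 'M[rat]_(n, m))).
Notation nW := (size (coset_reps (denom F G) (in_V_tens_dualW G) : seq 'M[rat]_(n, m))).

(** The two equations are [gauss_perp] and [card_perp] for the subgroup [inB]; [r] counts the [x]
    with [lat x] in Z, the common fibre size. *)
Lemma diag_reciprocity : exists2 r : nat,
  (\sum_x qchar x) * (r%:R * SW)^*%C = (r%:R * nW%:R) * (r%:R * SV) &
  (r%:R * nV%:R) * (r%:R * nW%:R) = (\sum_x qchar x) * (\sum_x qchar x)^*%C.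
Proof.
have sum1 (t : seq 'M[rat]_(n, m)) : \sum_(X <- t) (1 : R[i]) = (size t)%:R.
  by rewrite big_const_seq count_predT iter_addr_0.
have card1 (B : pred E) : \sum_(x | B x) (1 : R[i]) = #|[pred x | B x]|%:R.
  by rewrite -sumr_const.
have cardV := sum_reps_V (fun=> 1) (fun _ _ _ _ => erefl).
have cardW := sum_reps_W (fun=> 1) (fun _ _ _ _ => erefl).
rewrite sum1 card1 in cardV; rewrite sum1 card1 in cardW.
exists #|[pred x | is_int_mx (lat x)]|.
  rewrite -cardW -sum_reps_V; last exact: qexp_mod.
  rewrite -sum_reps_W; last exact: qexp_mod.
  rewrite (gauss_perp _ _ qcharD bcharC bcharD qchar_conj [pred y | inB y] inB_sub).
  by congr (_ * _); apply: eq_bigl => x; rewrite perp_inB.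
rewrite -cardV -cardW.
rewrite -(card_perp _ _ qcharD bcharC bcharD qchar_conj [pred y | inB y] inB_sub).
- by congr (_ * _); congr (_%:R); apply: eq_card => x; rewrite perp_inB.
- move=> y /rad_int[U hU]; rewrite inE /inB hU -intmxM; exact: is_int_intmx.
- move=> y /rad_int[U hU]; rewrite /qchar hU; apply: expi2pi_ratr_int; exact: hz.
Qed.

End DiagonalSublattice.

(** * The orders of the radicals and the normalization of the Gauss sums *)

Section Gamma.
Context {n m : nat} (F : 'M[int]_n) (G : 'M[int]_m).
Hypotheses (Fsym : F^T = F) (Gsym : G^T = G).
Hypotheses (Fnd : \det F != 0) (Gnd : \det G != 0).
Context (z : 'M[rat]_(n, m)).
Implicit Types X Y : 'M[rat]_(n, m).

Lemma phi_polar X Y :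
  phi F G z (X + Y) - phi F G z X - phi F G z Y = tform F G X Y.
Proof. by rewrite phiD //; ring. Qed.

Lemma mem_coset_reps (D : nat) (inL : 'M[rat]_(n, m) -> bool) (K : 'M['I_D]_(n, m)) :
  inL (frac_mx K) -> frac_mx K \in coset_reps D inL.
Proof. by move=> h; rewrite mem_filter h map_f // mem_enum. Qed.

Lemma coset_reps_sub (D : nat) (inL : 'M[rat]_(n, m) -> bool) X :
  X \in coset_reps D inL -> inL X.
Proof. by rewrite mem_filter => /andP[]. Qed.

(** For [X] in Z^# the pairing with [Y] modulo integers depends only on [Y] modulo Z, so the
    representatives suffice as tests. *)
Lemma all_coset_reps (D : nat) (inL : 'M[rat]_(n, m) -> bool) X :
  (0 < D)%N -> (forall Y, inL Y -> is_int_mx (D%:R *: Y)) ->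
  (forall Y Y', is_int_mx (Y - Y') -> inL Y -> inL Y') -> in_dual_tensor F G X ->
  all (fun Y => tform F G X Y \is a Num.int) (coset_reps D inL) ->
  forall Y, inL Y -> tform F G X Y \is a Num.int.
Proof.
move=> D0 Lden Lmod hX /allP h Y hY.
have [K hK] := frac_mx_ex _ _ D0 (Lden _ hY).
have := h _ (mem_coset_reps _ _ _ (Lmod _ _ hK hY)).
case/is_int_mxP: hK => U hU.
have {1}-> : frac_mx K = Y - intmx U by rewrite -hU opprB addrC subrK.
rewrite tformDr // -intmxN => h'.
by rewrite -(rpredDr _ (tform_int F G Fsym Gsym X (- U) hX)).
Qed.

Lemma perp_reps_V X : in_dualV_tens_W F X ->
  all (fun Y => phi F G z (X + Y) - phi F G z X - phi F G z Y \is a Num.int)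
      (coset_reps (denom F G) (in_dualV_tens_W F)) = in_V_tens_dualW G X.
Proof.
rewrite in_dualV_tens_WE // in_V_tens_dualWE // => hX.
under eq_all => Y do rewrite phi_polar.
apply/idP/idP => [h|hW].
  apply: (dual_dualV_tens_W F G) => // Y hY.
  apply: (all_coset_reps _ _ _ _ _ _ _ h).
  - exact: denom_gt0.
  - by move=> Y'; rewrite in_dualV_tens_WE //; exact: denom_V.
  - move=> Y1 Y2 h12; rewrite !in_dualV_tens_WE // -{1}(subrK Y2 Y1) [Y1 - Y2 + Y2]addrC.
    by rewrite mulmxDr is_int_mxDr //; apply: is_int_mxM h12; exact: is_int_intmx.
  - exact: in_dual_tensor_V.
  - by rewrite in_dualV_tens_WE.
apply/allP => Y /coset_reps_sub; rewrite in_dualV_tens_WE // tformC // => hY.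
exact: tform_dual_int.
Qed.

Lemma perp_reps_W X : in_V_tens_dualW G X ->
  all (fun Y => phi F G z (X + Y) - phi F G z X - phi F G z Y \is a Num.int)
      (coset_reps (denom F G) (in_V_tens_dualW G)) = in_dualV_tens_W F X.
Proof.
rewrite in_dualV_tens_WE // in_V_tens_dualWE // => hX.
under eq_all => Y do rewrite phi_polar.
apply/idP/idP => [h|hW].
  apply: (dual_V_tens_dualW F G) => // Y hY.
  apply: (all_coset_reps _ _ _ _ _ _ _ h).
  - exact: denom_gt0.
  - by move=> Y'; rewrite in_V_tens_dualWE //; exact: denom_W.
  - move=> Y1 Y2 h12; rewrite !in_V_tens_dualWE // -{1}(subrK Y2 Y1) [Y1 - Y2 + Y2]addrC.
    by rewrite mulmxDl is_int_mxDr //; apply: is_int_mxM h12 _; exact: is_int_intmx.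
  - exact: in_dual_tensor_W.
  - by rewrite in_V_tens_dualWE.
apply/allP => Y /coset_reps_sub; rewrite in_V_tens_dualWE // => hY.
exact: tform_dual_int.
Qed.

(** Each of the two groups has the other as its orthogonal complement, so both radicals are their
    intersection. *)
Lemma size_perp_reps :
  size [seq X <- coset_reps (denom F G) (in_dualV_tens_W F) |
    all (fun Y => phi F G z (X + Y) - phi F G z X - phi F G z Y \is a Num.int)
      (coset_reps (denom F G) (in_dualV_tens_W F))] =
  size [seq X <- coset_reps (denom F G) (in_V_tens_dualW G) |
    all (fun Y => phi F G z (X + Y) - phi F G z X - phi F G z Y \is a Num.int)
      (coset_reps (denom F G) (in_V_tens_dualW G))].
Proof.
rewrite (eq_in_filter (a2 := in_V_tens_dualW G)); last first.
  by move=> X /coset_reps_sub; exact: perp_reps_V.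
rewrite [in RHS](eq_in_filter (a2 := in_dualV_tens_W F)); last first.
  by move=> X /coset_reps_sub; exact: perp_reps_W.
by rewrite /coset_reps -!filter_predI; congr size; apply: eq_filter => X; rewrite /= andbC.
Qed.

(** The Wu property makes the pairing of [U] with [z] congruent modulo 2 to that of [U] with itself,
    hence integral. *)
Lemma Wu_in_dual_tensor : is_Wu_class F G z -> in_dual_tensor F G z.
Proof.
move=> hz; apply: in_dual_tensorP => // U; rewrite tformC //.
have -> : tform F G (intmx U) z = tform F G (intmx U) (intmx U) -
  2 * ((tform F G (intmx U) (intmx U) - tform F G (intmx U) z) / 2) by field.
apply: rpredB; last by apply: rpredM; [exact: (intr_int _ 2)|exact: hz].
by apply: tform_int => //; rewrite /in_dual_tensor -!intmxM is_int_intmx.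
Qed.

End Gamma.

(** The second identity and positivity give [rho = r sqrt (nV nW)]. Dividing the first by this
    leaves the reciprocity, and the common factor from [s], the order of both radicals, splits
    off. *)
Lemma normalized_reciprocity (R : realType) (SV SW u : R[i]) (rho : R) (r nV nW : nat) :
  0 < rho -> u * u^*%C = 1 ->
  (rho%:C%C * u) * (r%:R * SW)^*%C = (r%:R * nW%:R) * (r%:R * SV) ->
  (r%:R * nV%:R) * (r%:R * nW%:R) = (rho%:C%C * u) * (rho%:C%C * u)^*%C ->
  forall s : nat,
  ((Num.sqrt (nV%:R * s%:R : R))^-1)%:C%C * SV =
  u * (((Num.sqrt (nW%:R * s%:R : R))^-1)%:C%C * SW)^*%C.
Proof.
move=> rho0 u1 h1 h2 s.
have cr (x : R) (w : R[i]) := conjc_realM x w.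
have natC (k : nat) : k%:R = (k%:R : R)%:C%C by rewrite rmorph_nat.
rewrite !natC -!(rmorphM (real_complex R)) cr in h1.
rewrite !natC -!(rmorphM (real_complex R)) cr in h2.
have {}h2 : r%:R * nV%:R * (r%:R * nW%:R) = rho ^+ 2 :> R.
  apply: (@complexI R); rewrite h2 mulrACA u1 mulr1 -rmorphM expr2 //.
have rho2 : 0 < rho ^+ 2 by rewrite exprn_gt0.
have r0 : 0 < r%:R :> R.
  by rewrite lt0r ler0n andbT; apply: contraTneq rho2 => r0; rewrite -h2 r0 !mul0r ltxx.
have nV0 : 0 < nV%:R :> R.
  rewrite lt0r ler0n andbT; apply: contraTneq rho2 => n0.
  by rewrite -h2 n0 !(mul0r, mulr0) ltxx.
have nW0 : 0 < nW%:R :> R.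
  rewrite lt0r ler0n andbT; apply: contraTneq rho2 => n0.
  by rewrite -h2 n0 !(mul0r, mulr0) ltxx.
set x := Num.sqrt (nV%:R : R); set y := Num.sqrt (nW%:R : R).
have x0 : 0 < x by rewrite sqrtr_gt0.
have y0 : 0 < y by rewrite sqrtr_gt0.
have x2 : nV%:R = x ^+ 2 by rewrite sqr_sqrtr ?ltW.
have y2 : nW%:R = y ^+ 2 by rewrite sqr_sqrtr ?ltW.
have rhoE : rho = r%:R * x * y.
  apply/eqP; rewrite -(eqrXn2 (n := 2)) ?ltW ?mulr_gt0 //; apply/eqP.
  by rewrite -h2 x2 y2; ring.
rewrite cr !sqrtrM ?ltW // -/x -/y.
have -> : (x * Num.sqrt s%:R)^-1 = (Num.sqrt s%:R)^-1 * x^-1 by rewrite invfM mulrC.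
have -> : (y * Num.sqrt s%:R)^-1 = (Num.sqrt s%:R)^-1 * y^-1 by rewrite invfM mulrC.
rewrite !(rmorphM (real_complex R)) /= mulrCA -!mulrA; congr (_ * _).
have toC0 (t : R) : 0 < t -> t%:C%C != 0 by move=> t0; rewrite fmorph_eq0 gt_eqF.
have [xC yC rC] := And3 (toC0 _ x0) (toC0 _ y0) (toC0 _ r0).
have SVE : SV = u * (x%:C%C / y%:C%C) * SW^*%C.
  move: h1; rewrite rhoE y2 => h1.
  apply: (mulfI (x := (r%:R * y ^+ 2)%:C%C * r%:R%:C%C)).
    by rewrite mulf_neq0 // toC0 // mulr_gt0 // exprn_gt0.
  apply: (etrans (etrans (esym (mulrA _ _ _)) (esym h1))).
  by rewrite !rmorphM /=; field; exact: yC.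
by rewrite SVE !fmorphV /=; field; rewrite xC yC.
Qed.

Theorem mainTheorem4 (R : realType) (n m : nat)
  (F : 'M[int]_n) (G : 'M[int]_m)
  (hFsym : F^T = F) (hGsym : G^T = G)
  (hFnd : \det F != 0) (hGnd : \det G != 0)
  (sf sg : int)
  (hsf : is_signature (intmx F) sf) (hsg : is_signature (intmx G) sg)
  (z : 'M[rat]_(n, m)) (hz : is_Wu_class F G z) :
  gauss_gamma R (coset_reps (denom F G) (in_dualV_tens_W F)) (phi F G z)
  = expi (pi / 4 * ((sf * sg)%:~R - ratr (tform F G z z)))
    * (gauss_gamma R (coset_reps (denom F G) (in_V_tens_dualW G)) (phi F G z))^*%C.
Proof.
have [P [a [Pnd Pdiag a0 a2 sfE]]] := signature_int_diag _ _ _ hFnd hsf.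
have [Q [b [Qnd Qdiag b0 _ sgE]]] := signature_int_diag _ _ _ hGnd hsg.
(* A common multiple of all diagonal values; the coordinates of [E] range over Z/M, so [p] is taken
   to be [M - 1]. *)
pose M := (\prod_i \prod_j `|dcoef a b i j|)%N.
have M0 : (0 < M)%N.
  apply: prodn_gt0 => i; apply: prodn_gt0 => j.
  by rewrite absz_gt0 mulf_neq0.
have pM : M.-1.+1 = M by rewrite prednK.
have dp i j : (dcoef a b i j %| M.-1.+1%:Z)%Z.
  by rewrite pM dvdzE /= /M (bigD1 i) //= (bigD1 j) //= -mulnA dvdn_mulr.
have zdual := Wu_in_dual_tensor F G hFsym hGsym z hz.
(* Because the basis is given by the doubled matrix [P + P], pairing [z] with the vector from [P]
   alone gives an integer that is half of a dual coordinate of [z]; the floor below is therefore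
   exact. *)
pose half i j := tform F G z (intmx (P *m delta_mx i j *m (Q + Q)^T)).
pose c : 'M[int]_(n, m) := \matrix_(i, j) Num.floor (half i j).
have zE : z = todual (P + P) (Q + Q) a b (c + c).
  apply: (todual_eq F G (P + P) (Q + Q) a b) => // i j.
  rewrite -intmx_delta tobasis_int !mulmxDl intmxD tformDr // !mxE intrD.
  by rewrite floorK // /half; exact: tform_int.
have [r h1 h2] := diag_reciprocity (R := R) F G hFsym hGsym hFnd hGnd
  (P + P) (Q + Q) a b Pnd Qnd Pdiag Qdiag a0 b0 M.-1 dp z hz.
have S := sum_qchar (R := R) F G (P + P) (Q + Q) a b Pdiag Qdiag a0 b0 a2 M.-1 dp z c zE.
rewrite -sfE -sgE in S; rewrite S in h1; rewrite S in h2.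
have u1 (t : R) : expi t * (expi t)^*%C = 1.
  by rewrite conjc_expi -expiD subrr expi0.
have H := normalized_reciprocity _ _ _ _ _ _ _ _
  (modulus_gt0 (R := R) a b a0 b0 M.-1) (u1 _) h1 h2.
by rewrite /gauss_gamma size_perp_reps //; exact: H.
Qed.
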